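(* Let $u_1,u_2,u_3:\mathbb{R}^2\to\mathbb{R}$ be smooth functions of $(q,t)$, periodic in both $q$ and $t$, which satisfy the quasi-linear system $$U_t+A(U)U_q=0,\qquad U=(u_1,u_2,u_3)^t,\qquad A(U)=-\begin{pmatrix}0&-1&0\\ 2u_1&0&-1\\ u_2&0&0\end{pmatrix}.$$ Then $u_1,u_2,u_3$ do not depend on $t$.
   Context: Subscripts $t$ and $q$ denote partial derivatives. Written out, the system is $(u_1)_t+(u_2)_q=0$, $(u_2)_t+(u_3)_q-2u_1(u_1)_q=0$, $(u_3)_t-u_2(u_1)_q=0$. It expresses that $F(p,q,t)=\frac14p^4+u_1p^2+u_2p+u_3$ satisfies $F_t+pF_q-(u_1)_qF_p=0$. In the paper, solutions of this form (independent of $t$) are called traveling wave solutions. *)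

(* Defs.v *)
From Stdlib Require Import Reals.
From Coquelicot Require Import Coquelicot.
Open Scope R_scope.

(* Functions on the plane take their arguments in the order (q, t). *)

(* [ex_diff_n u n q t] says that all iterated partial derivatives of [u] of
   order at most [n] exist and are continuous, as functions of two variables,
   at the point (q, t). *)
Definition smooth (u : R -> R -> R) : Prop :=
  forall (n : nat) (q t : R), ex_diff_n u n q t.

Definition dq (u : R -> R -> R) (q t : R) : R := Derive (fun x : R => u x t) q.

Definition dt (u : R -> R -> R) (q t : R) : R := Derive (fun s : R => u q s) t.

(* The periods are arbitrary: the two variables, and different functions, may
   have different ones. *)
Definition biperiodic (u : R -> R -> R) : Prop :=
  (exists T : R, 0 < T /\ forall q t : R, u (q + T) t = u q t) /\
  (exists T : R, 0 < T /\ forall q t : R, u q (t + T) = u q t).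

(* Coquelicot's [matrix m n] is a vector of rows, each vector being a nested
   pair that ends with [tt]. *)
Definition col3 (a b c : R) : @matrix R 3 1 :=
  ((a, tt), ((b, tt), ((c, tt), tt))).

Definition mat3 (a11 a12 a13 a21 a22 a23 a31 a32 a33 : R) : @matrix R 3 3 :=
  ((a11, (a12, (a13, tt))),
   ((a21, (a22, (a23, tt))),
    ((a31, (a32, (a33, tt))), tt))).

Definition mxA (U : @matrix R 3 1) : @matrix R 3 3 :=
  let u1 := coeff_mat 0 U 0 0 in
  let u2 := coeff_mat 0 U 1 0 in
  opp (mat3     0     (-1)    0
            (2 * u1)   0    (-1)
               u2      0      0).

Definition quasilinear_system (u1 u2 u3 : R -> R -> R) : Prop :=
  forall q t : R,
    plus (col3 (dt u1 q t) (dt u2 q t) (dt u3 q t))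
         (Mmult (mxA (col3 (u1 q t) (u2 q t) (u3 q t)))
                (col3 (dq u1 q t) (dq u2 q t) (dq u3 q t)))
    = zero.

Lemma quasilinear_systemE (u1 u2 u3 : R -> R -> R) :
  quasilinear_system u1 u2 u3 <->
  forall q t : R,
    dt u1 q t + dq u2 q t = 0 /\
    dt u2 q t + dq u3 q t - 2 * u1 q t * dq u1 q t = 0 /\
    dt u3 q t - u2 q t * dq u1 q t = 0.
Proof.
split; intros H q t; specialize (H q t).
- cbv -[Rplus Rmult Ropp dq dt IZR] in H.
  injection H as H1 H2 H3.
  repeat split; [rewrite <- H1 | rewrite <- H2 | rewrite <- H3]; ring.
- destruct H as [H1 [H2 H3]].
  cbv -[Rplus Rmult Ropp dq dt IZR].
  repeat apply (f_equal2 (@pair _ _)); try reflexivity;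
    [transitivity (dt u1 q t + dq u2 q t)
    |transitivity (dt u2 q t + dq u3 q t - 2 * u1 q t * dq u1 q t)
    |transitivity (dt u3 q t - u2 q t * dq u1 q t)]; trivial; ring.
Qed.

Definition indep_of_t (u : R -> R -> R) : Prop :=
  forall q t s : R, u q t = u q s.

(* Main.v *)
Require Import Defs.
From Stdlib Require Import ZArith Reals Lra Classical IndefiniteDescription.
From Coquelicot Require Import Coquelicot.
Open Scope R_scope.

(** Write (u, v, w) for the three unknowns and let
    F(p) = p^4/4 + u p^2 + v p + w. The system says that
    F_t + p F_q - u_q F_p = 0 identically in p. At a simple root l of the cubic
    F_p = p^3 + 2 u p + v this gives r_t + l r_q = 0 for the critical value
    r = F(l), and r_q = F_q(l), where F_q(p) = u_q p^2 + v_q p + w_q. So the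
    critical values are Riemann invariants, and the roots of F_p are the
    characteristic speeds. The sign of D = 32 u^3 + 27 v^2 decides the type: one
    real root and two conjugate ones for D > 0 (elliptic), three distinct real
    roots for D < 0 (hyperbolic). The proof shows that F_q vanishes wherever
    v <> 0 and either D <> 0 or D vanishes in a neighbourhood. Then F_t vanishes
    there too; it also vanishes in the interior of v = 0, directly from the
    system. Together these points are dense, so F_t = 0 everywhere.

    The elliptic part, [elliptic_invariants_constant]. For a nonreal root
    l = x + i y with y > 0 the critical value r = rho + i sigma satisfies a
    Beltrami equation, so the Jacobian sigma_t rho_q - sigma_q rho_t equals
    - y |r_q|^2 and has a sign. For a nondecreasing function psi that
    vanishes near 0, the form psi(sigma) d rho extends by zero to the whole torus,
    because sigma tends to 0 where D does. Its differential integrates to zero,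
    hence r_q = 0 wherever sigma <> 0. As sigma = 2 x y^3 and the real root is
    - 2 x, this is the set D > 0, v <> 0.

    Real roots, [real_invariant_constant]. Let u <= 0 and let l be a real root
    with F_pp(l) > 0, such as the outer roots for D < 0. Along the field
    d/dt + l d/dq the quantity Y = r_q sqrt(F_pp(l)) obeys the Riccati equation
    Y' = 3 l F_pp(l)^(-5/2) Y^2. It vanishes where l becomes a multiple root.
    If Y were not zero, Y^2 would have a positive maximum, attained where u < 0
    because the elliptic part excludes the boundary u = 0. There Y' = 0,
    although l <> 0, since 3 l^2 > - 2 u. So r_q = 0. To avoid solving F_p = 0
    for l, the maximum is taken over all (p, q, t), with a large penalty on
    F_p^2.

    What remains, [one_invariant_trivial]. Both parts leave at most one
    nonconstant invariant, at a real root l: then v_q = l u_q and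
    w_q = (2 u + l^2) u_q, the state (u, v, w) is constant along d/dt + l d/dq,
    and the derivative of v_q along this field is 3 v_q^2 / F_pp(l). A maximum
    of (D v v_q)^2 is then impossible unless v_q = 0. Since l <> 0 when v <> 0,
    this forces u_q = 0, hence F_q = 0. If D vanishes on an open set,
    [double_root_trivial] reaches the same conclusion by differentiating D = 0.

    All maxima and integrals need common periods for the three functions; the
    system provides them, see [common_periods]. *)

(** * Smooth functions of two variables *)

Lemma smooth_dq (u : R -> R -> R) : smooth u -> smooth (dq u).
Proof. intros H n q t; exact (proj1 (proj2 (proj2 (proj2 (H (S n) q t))))). Qed.

Lemma smooth_dt (u : R -> R -> R) : smooth u -> smooth (dt u).
Proof. intros H n q t; exact (proj2 (proj2 (proj2 (proj2 (H (S n) q t))))). Qed.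

Lemma smooth_continuity_2d (u : R -> R -> R) (q t : R) :
  smooth u -> continuity_2d_pt u q t.
Proof. intros H; exact (proj1 (H 0%nat q t)). Qed.

Lemma smooth_continuous (u : R -> R -> R) (z : R * R) :
  smooth u -> continuous (fun z : R * R => u (fst z) (snd z)) z.
Proof.
intros H; destruct z as [q t].
exact (proj1 (continuity_2d_pt_filterlim u q t) (smooth_continuity_2d u q t H)).
Qed.

Lemma smooth_is_derive_q (u : R -> R -> R) (q t : R) :
  smooth u -> is_derive (fun x => u x t) q (dq u q t).
Proof. intros H; apply Derive_correct; exact (proj1 (proj2 (H 1%nat q t))). Qed.

Lemma smooth_is_derive_t (u : R -> R -> R) (q t : R) :
  smooth u -> is_derive (fun s => u q s) t (dt u q t).
Proof. intros H; apply Derive_correct; exact (proj1 (proj2 (proj2 (H 1%nat q t)))). Qed.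

Lemma smooth_Schwarz (u : R -> R -> R) (q t : R) :
  smooth u -> dt (dq u) q t = dq (dt u) q t.
Proof.
intros H; symmetry; apply Schwarz.
- apply locally_2d_forall; intros x y; repeat split.
  + eexists; apply smooth_is_derive_q, H.
  + eexists; apply smooth_is_derive_t, H.
  + eexists; apply (smooth_is_derive_q (dt u)), smooth_dt, H.
  + eexists; apply (smooth_is_derive_t (dq u)), smooth_dq, H.
- apply (smooth_continuity_2d (dq (dt u))), smooth_dq, smooth_dt, H.
- apply (smooth_continuity_2d (dt (dq u))), smooth_dt, smooth_dq, H.
Qed.

Lemma smooth_is_derive_line (u : R -> R -> R) (q t a b : R) :
  smooth u ->
  is_derive (fun s => u (q + s * a) (t + s * b)) 0 (a * dq u q t + b * dt u q t).
Proof.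
intros H.
replace (a * dq u q t + b * dt u q t) with (dq u q t * a + dt u q t * b) by ring.
apply is_derive_Reals.
apply (derivable_pt_lim_comp_2d u (fun s => q + s * a) (fun s => t + s * b)).
- replace (q + 0 * a) with q by ring; replace (t + 0 * b) with t by ring.
  apply filterdiff_differentiable_pt_lim.
  apply (is_derive_filterdiff u q t (dq u) (dt u q t)).
  + apply filter_forall; intros z; apply smooth_is_derive_q, H.
  + apply smooth_is_derive_t, H.
  + apply (smooth_continuous (dq u) (q, t)), smooth_dq, H.
- apply is_derive_Reals; auto_derive; trivial; ring.
- apply is_derive_Reals; auto_derive; trivial; ring.
Qed.

(** * Critical points in one variable *)

Lemma is_derive_local_max (h : R -> R) (x l : R) :
  is_derive h x l -> locally x (fun y => h y <= h x) -> l = 0.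
Proof.
intros Hd [eps Hm].
assert (Hp : derivable_pt h x) by (exists l; apply is_derive_Reals, Hd).
rewrite <- (deriv_maximum h (x - eps) (x + eps) x Hp).
- symmetry; apply derive_pt_eq_0, is_derive_Reals, Hd.
- destruct eps as [e He]; simpl; lra.
- destruct eps as [e He]; simpl; lra.
- intros y H1 H2; apply Hm, Rabs_def1; unfold minus, plus, opp; simpl in *; lra.
Qed.

Lemma is_derive_loc_zero (h : R -> R) (x l : R) :
  is_derive h x l -> locally x (fun y => h y = 0) -> l = 0.
Proof.
intros Hd Hz; apply (is_derive_local_max h x l Hd).
generalize (locally_singleton _ _ Hz); intros H0.
apply filter_imp with (2 := Hz); intros y ->; rewrite H0; lra.
Qed.

Lemma is_derive_zero_const (f : R -> R) :
  (forall x, is_derive f x 0) -> forall x y, f x = f y.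
Proof.
intros D x y; destruct (Rtotal_order x y) as [H|[->|H]]; trivial.
- apply (eq_is_derive f); auto; intros; apply D.
- symmetry; apply (eq_is_derive f); auto; intros; apply D.
Qed.

(** * Maxima on the torus *)

(** Each point carries a radius on which f exceeds |f(x)| + 1 nowhere, and
    which is at most 1 / (|f(x)| + 1). By compactness such radii can be chosen
    bounded below by some d, which turns into the bound 1 / d on f. *)
Lemma box_bounded (f : R * (R * R) -> R) (a1 b1 a2 b2 a3 b3 : R) :
  (forall x y z, a1 <= x <= b1 -> a2 <= y <= b2 -> a3 <= z <= b3 ->
     continuous f (x, (y, z))) ->
  exists M, forall x y z, a1 <= x <= b1 -> a2 <= y <= b2 -> a3 <= z <= b3 ->
     f (x, (y, z)) <= M.
Proof.
intros Hf.
assert (Hdel : forall p : Compactness.Tn 3 R, exists d : posreal,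
   bounded_n 3 (a1,(a2,(a3,tt))) (b1,(b2,(b3,tt))) p ->
   let '(x, (y, (z, _))) := p in
   d <= / (Rabs (f (x, (y, z))) + 1) /\
   forall x' y' z', Rabs (x' - x) < d -> Rabs (y' - y) < d -> Rabs (z' - z) < d ->
     f (x', (y', z')) < Rabs (f (x, (y, z))) + 1).
{ intros (x, (y, (z, []))).
  destruct (classic
     (bounded_n 3 (a1,(a2,(a3,tt))) (b1,(b2,(b3,tt))) (x,(y,(z,tt))))) as [Hb|Hb].
  2: { exists (mkposreal 1 Rlt_0_1); intros; contradiction. }
  destruct Hb as (Hx & Hy & Hz & _).
  destruct (proj1 (filterlim_locally _ _) (Hf x y z Hx Hy Hz) (mkposreal 1 Rlt_0_1))
    as [e He].
  assert (Hp : 0 < / (Rabs (f (x, (y, z))) + 1)).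
  { apply Rinv_0_lt_compat; generalize (Rabs_pos (f (x,(y,z)))); lra. }
  assert (Hm : 0 < Rmin e (/ (Rabs (f (x, (y, z))) + 1))).
  { apply Rmin_pos; [apply cond_pos | exact Hp]. }
  exists (mkposreal _ Hm); intros _; split; simpl; [apply Rmin_r|].
  intros x' y' z' H1 H2 H3.
  assert (Hb : ball (x, (y, z)) e (x', (y', z'))).
  { repeat split; simpl; eapply Rlt_le_trans; try eassumption; apply Rmin_l. }
  generalize (He _ Hb); unfold ball; simpl; unfold AbsRing_ball, abs, minus, plus, opp; simpl.
  intros H4; apply Rabs_def2 in H4.
  generalize (Rle_abs (f (x, (y, z)))); lra. }
apply functional_choice in Hdel; destruct Hdel as [del Hspec].
destruct (compactness_value 3 (a1,(a2,(a3,tt))) (b1,(b2,(b3,tt))) del) as [d Hd].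
exists (/ d); intros x y z Hx Hy Hz.
apply Rnot_lt_le; intros Hlt.
apply (Hd (x,(y,(z,tt)))); [repeat split; lra|].
intros ((x0,(y0,(z0,[]))) & Hbd & Hcl & Hle).
generalize (Hspec _ Hbd); intros [H1 H2].
destruct Hcl as (C1 & C2 & C3 & _).
generalize (H2 x y z C1 C2 C3); intros H3.
assert (H4 : d <= / (Rabs (f (x0, (y0, z0))) + 1)) by lra.
assert (H5 : Rabs (f (x0, (y0, z0))) + 1 <= / d).
{ rewrite <- (Rinv_inv (Rabs (f (x0, (y0, z0))) + 1)).
  apply Rinv_le_contravar; [apply cond_pos | exact H4]. }
lra.
Qed.

(** If the supremum S were not attained, 1 / (S - f) would be continuous, hence
    bounded, and S would not be the least upper bound. *)
Lemma box_maximum (f : R * (R * R) -> R) (a1 b1 a2 b2 a3 b3 : R) :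
  a1 <= b1 -> a2 <= b2 -> a3 <= b3 ->
  (forall x y z, a1 <= x <= b1 -> a2 <= y <= b2 -> a3 <= z <= b3 ->
     continuous f (x, (y, z))) ->
  exists x y z, a1 <= x <= b1 /\ a2 <= y <= b2 /\ a3 <= z <= b3 /\
    forall x' y' z', a1 <= x' <= b1 -> a2 <= y' <= b2 -> a3 <= z' <= b3 ->
     f (x', (y', z')) <= f (x, (y, z)).
Proof.
intros L1 L2 L3 Hf.
destruct (box_bounded f a1 b1 a2 b2 a3 b3 Hf) as [M HM].
pose (E r := exists x y z, a1 <= x <= b1 /\ a2 <= y <= b2 /\ a3 <= z <= b3 /\
   r = f (x, (y, z))).
destruct (completeness E) as [S [HS1 HS2]].
{ exists M; intros r (x & y & z & Hx & Hy & Hz & ->); auto. }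
{ exists (f (a1, (a2, a3))), a1, a2, a3; repeat split; lra. }
apply NNPP; intros Hno.
assert (Hlt : forall x y z, a1 <= x <= b1 -> a2 <= y <= b2 -> a3 <= z <= b3 ->
   f (x, (y, z)) < S).
{ intros x y z Hx Hy Hz; apply Rnot_le_lt; intros Hle; apply Hno.
  exists x, y, z; repeat split; try lra.
  intros x' y' z' Hx' Hy' Hz'; apply Rle_trans with (2 := Hle), HS1.
  exists x', y', z'; repeat split; lra. }
destruct (box_bounded (fun p : R * (R * R) => / (S - f p)) a1 b1 a2 b2 a3 b3) as [K HK].
{ intros x y z Hx Hy Hz.
  apply (continuous_comp (fun p : R * (R * R) => S - f p) Rinv).
  - apply (continuous_minus (fun _ : R * (R * R) => S) f); [apply continuous_const | auto].
  - apply continuous_Rinv; generalize (Hlt x y z Hx Hy Hz); lra. }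
assert (HKp : 0 < K).
{ eapply Rlt_le_trans; [|apply (HK a1 a2 a3); lra].
  apply Rinv_0_lt_compat; generalize (Hlt a1 a2 a3); lra. }
assert (HSK : S <= S - / K).
{ apply HS2; intros r (x & y & z & Hx & Hy & Hz & ->).
  generalize (Hlt x y z Hx Hy Hz) (HK x y z Hx Hy Hz); intros H1 H2.
  assert (/ K <= S - f (x, (y, z))); [|lra].
  rewrite <- (Rinv_inv (S - f (x, (y, z)))).
  apply Rinv_le_contravar; [apply Rinv_0_lt_compat; lra | exact H2]. }
generalize (Rinv_0_lt_compat K HKp); lra.
Qed.
Lemma periodic_Z (f : R -> R) (T : R) :
  (forall x, f (x + T) = f x) -> forall (n : Z) x, f (x + IZR n * T) = f x.
Proof.
intros Hf.
assert (Hn : forall (n : nat) x, f (x + INR n * T) = f x).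
{ induction n as [|n IH]; intros x.
  - f_equal; simpl; ring.
  - rewrite S_INR, <- (IH x), <- (Hf (x + INR n * T)); f_equal; ring. }
intros n x; destruct n as [|n|n].
- f_equal; ring.
- rewrite <- (positive_nat_Z n), <- INR_IZR_INZ; apply Hn.
- rewrite <- (Hn (Pos.to_nat n)); f_equal.
  rewrite INR_IZR_INZ, positive_nat_Z, <- Pos2Z.opp_pos, opp_IZR; ring.
Qed.

Lemma period_reduction (T x : R) : 0 < T -> exists n : Z, 0 <= x + IZR n * T <= T.
Proof.
intros HT; exists (1 - up (x / T))%Z; rewrite minus_IZR.
destruct (archimed (x / T)) as [H1 H2].
assert (Hx : x = x / T * T) by (field; lra).
assert (IZR (up (x / T)) * T <= (x / T + 1) * T) by (apply Rmult_le_compat_r; lra).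
assert (x / T * T <= IZR (up (x / T)) * T) by (apply Rmult_le_compat_r; lra).
lra.
Qed.

Lemma torus_maximum (f : R * (R * R) -> R) (B Q T : R) :
  0 <= B -> 0 < Q -> 0 < T ->
  (forall x, continuous f x) ->
  (forall p q t, f (p, (q + Q, t)) = f (p, (q, t))) ->
  (forall p q t, f (p, (q, t + T)) = f (p, (q, t))) ->
  exists p q t, - B <= p <= B /\
    forall p' q' t', - B <= p' <= B -> f (p', (q', t')) <= f (p, (q, t)).
Proof.
intros HB HQ HT Hf PQ PT.
destruct (box_maximum f (- B) B 0 Q 0 T) as (p & q & t & Hp & Hq & Ht & Hm); try lra.
{ intros; apply Hf. }
exists p, q, t; split; [exact Hp|]; intros p' q' t' Hp'.
destruct (period_reduction Q q' HQ) as [n Hn], (period_reduction T t' HT) as [m Hm'].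
rewrite <- (periodic_Z (fun x => f (p', (x, t'))) Q (fun x => PQ p' x t') n q').
rewrite <- (periodic_Z (fun x => f (p', (_, x))) T (fun x => PT p' _ x) m t').
apply Hm; assumption.
Qed.

Lemma torus_bounded_3d (f : R * (R * R) -> R) (B Q T : R) :
  0 <= B -> 0 < Q -> 0 < T -> (forall x, continuous f x) ->
  (forall p q t, f (p, (q + Q, t)) = f (p, (q, t))) ->
  (forall p q t, f (p, (q, t + T)) = f (p, (q, t))) ->
  exists M, forall p q t, - B <= p <= B -> f (p, (q, t)) <= M.
Proof.
intros HB HQ HT Hf PQ PT.
destruct (torus_maximum f B Q T) as (p & q & t & _ & Hm); trivial.
exists (f (p, (q, t))); intros; now apply Hm.
Qed.

Definition continuous2 (f : R -> R -> R) : Prop :=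
  forall z, continuous (fun z : R * R => f (fst z) (snd z)) z.

Lemma torus_maximum_2d (f : R -> R -> R) (Q T : R) :
  0 < Q -> 0 < T ->
  continuous2 f ->
  (forall q t, f (q + Q) t = f q t) -> (forall q t, f q (t + T) = f q t) ->
  exists q t, forall q' t', f q' t' <= f q t.
Proof.
intros HQ HT Hf PQ PT.
destruct (torus_maximum (fun x => f (fst (snd x)) (snd (snd x))) 0 Q T)
  as (p & q & t & _ & Hm); try (simpl; auto; lra).
- intros x.
  apply (continuous_comp snd (fun z : R * R => f (fst z) (snd z))); [|apply Hf].
  destruct x; apply continuous_snd.
- exists q, t; intros q' t'; apply (Hm 0); lra.
Qed.

Lemma torus_bounded_2d (f : R -> R -> R) (Q T : R) :
  0 < Q -> 0 < T ->
  continuous2 f ->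
  (forall q t, f (q + Q) t = f q t) -> (forall q t, f q (t + T) = f q t) ->
  exists M, forall q t, Rabs (f q t) <= M.
Proof.
intros HQ HT Hf PQ PT.
destruct (torus_maximum_2d (fun q t => Rabs (f q t)) Q T) as (q & t & Hm); auto.
- intros z; apply (continuous_comp (fun z : R * R => f (fst z) (snd z)) Rabs);
    [apply Hf | apply continuous_Rabs].
- intros; now rewrite PQ.
- intros; now rewrite PT.
- exists (Rabs (f q t)); auto.
Qed.

(** * A periodic divergence that has a sign vanishes *)

Lemma continuous2_slice_q (f : R -> R -> R) (q t : R) :
  continuous2 f -> continuous (fun x => f x t) q.
Proof.
intros H; apply (continuous_comp_2 (fun x => x) (fun _ => t) f).
- apply continuous_id.
- apply continuous_const.
- apply H.
Qed.

(** The integral I(t) of Y over a period in q has derivative the integral of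
    X_q + Y_t, because X_q integrates to zero. Hence I is nonincreasing, and it
    is periodic, so it is constant and the integrand vanishes. *)
Lemma torus_nonpositive_divergence (X Y Xq Yt : R -> R -> R) (Q T : R) :
  0 < Q -> 0 < T ->
  (forall q t, X (q + Q) t = X q t) -> (forall q t, Y q (t + T) = Y q t) ->
  (forall q t, is_derive (fun x => X x t) q (Xq q t)) ->
  (forall q t, is_derive (fun s => Y q s) t (Yt q t)) ->
  continuous2 Y -> continuous2 Xq -> continuous2 Yt ->
  (forall q t, Xq q t + Yt q t <= 0) ->
  forall q t, Xq q t + Yt q t = 0.
Proof.
intros HQ HT PX PY DX DY CY CX' CY' Hneg q0 t0.
pose (J q t := Xq q t + Yt q t).
assert (CJ : forall t q, continuous (fun x => J x t) q).
{ intros t q; apply (continuous_plus (fun x => Xq x t) (fun x => Yt x t));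
    apply continuous2_slice_q; assumption. }
assert (IJ : forall t a b, ex_RInt (fun x => J x t) a b).
{ intros; apply (ex_RInt_continuous (V := R_CompleteNormedModule)); intros; apply CJ. }
pose (I t := RInt (fun x => Y x t) q0 (q0 + Q)).
assert (DI : forall t, is_derive I t (RInt (fun x => J x t) q0 (q0 + Q))).
{ intros t.
  replace (RInt (fun x => J x t) q0 (q0 + Q))
    with (RInt (fun x => Derive (fun s => Y x s) t) q0 (q0 + Q)).
  - apply (is_derive_RInt_param (fun s x => Y x s)).
    + apply filter_forall; intros s x _; eexists; apply DY.
    + intros x _; apply continuity_2d_pt_ext with (f := fun s x => Yt x s).
      * intros s y; symmetry; apply is_derive_unique, DY.
      * apply (proj2 (continuity_2d_pt_filterlim (fun s x => Yt x s) t x)).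
        apply (continuous_comp_2 snd fst Yt (t, x));
          [apply continuous_snd | apply continuous_fst | apply CY'].
    + apply filter_forall; intros s.
      apply (ex_RInt_continuous (V := R_CompleteNormedModule)).
      intros; apply continuous2_slice_q; assumption.
  - assert (HX : is_RInt (fun x => Xq x t) q0 (q0 + Q) 0).
    { replace 0 with (minus (X (q0 + Q) t) (X q0 t))
        by (rewrite PX; unfold minus, plus, opp; simpl; ring).
      apply (is_RInt_derive (fun x => X x t)); intros;
        [apply DX | apply continuous2_slice_q; assumption]. }
    assert (HY : ex_RInt (fun x => Yt x t) q0 (q0 + Q)).
    { apply (ex_RInt_continuous (V := R_CompleteNormedModule)).
      intros; apply continuous2_slice_q; assumption. }
    rewrite (RInt_ext (fun x => Derive (fun s => Y x s) t) (fun x => Yt x t))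
      by (intros; apply is_derive_unique, DY).
    unfold J; transitivity (plus (RInt (fun x => Xq x t) q0 (q0 + Q))
                                 (RInt (fun x => Yt x t) q0 (q0 + Q))).
    + rewrite (is_RInt_unique _ _ _ _ HX); exact (eq_sym (Rplus_0_l _)).
    + symmetry; apply (RInt_plus (V := R_CompleteNormedModule)); trivial.
      exists 0; exact HX. }
assert (SI : forall t, RInt (fun x => J x t) q0 (q0 + Q) <= 0).
{ intros t; apply Ropp_le_cancel; rewrite Ropp_0.
  change (- RInt (fun x => J x t) q0 (q0 + Q))
    with (opp (RInt (fun x => J x t) q0 (q0 + Q))).
  rewrite <- (RInt_opp (V := R_CompleteNormedModule)) by apply IJ.
  apply RInt_ge_0; [lra | apply (ex_RInt_opp (V := R_CompleteNormedModule)), IJ |].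
  intros x _; generalize (Hneg x t); unfold J, opp; simpl; lra. }
assert (MI : forall a b, a <= b -> I b <= I a).
{ intros a b Hab.
  destruct (MVT_gen I a b (fun t => RInt (fun x => J x t) q0 (q0 + Q))) as (c & _ & Hc).
  - intros; apply DI.
  - intros t _; apply continuity_pt_filterlim.
    apply (ex_derive_continuous I); eexists; apply DI.
  - generalize (SI c); nra. }
assert (PI : forall t, I (t + T) = I t).
{ intros t; apply RInt_ext; intros; apply PY. }
(* I is squeezed between its equal values at t0 - T and t0 + T. *)
assert (ZI : RInt (fun x => J x t0) q0 (q0 + Q) = 0).
{ rewrite <- (is_derive_unique _ _ _ (DI t0)).
  apply is_derive_unique, is_derive_ext_loc with (f := fun _ => I t0).
  - exists (mkposreal T HT); intros s Hs; apply Rabs_def2 in Hs.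
    unfold minus, plus, opp in Hs; simpl in Hs.
    assert (H1 := MI (t0 - T) s ltac:(lra)).
    assert (H2 := MI s (t0 + T) ltac:(lra)).
    generalize (PI t0) (PI (t0 - T)); replace (t0 - T + T) with t0 by ring; lra.
  - apply (is_derive_const (I t0)). }
(* A negative value at q0 would make the integral over [q0, q0 + e] negative. *)
apply Rle_antisym; [apply Hneg | apply Rnot_lt_le; intros Hlt].
destruct (proj1 (filterlim_locally _ _) (CJ t0 q0) (mkposreal _ (Ropp_0_gt_lt_contravar _ Hlt)))
  as [d Hd].
pose (e := Rmin (d / 2) (Q / 2)).
assert (He : 0 < e < d /\ e < Q).
{ destruct d as [d Hd0]; unfold e; simpl; unfold Rmin; destruct (Rle_dec _ _); lra. }
assert (H1 : 0 < RInt (fun x => opp (J x t0)) q0 (q0 + e)).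
{ apply RInt_gt_0; [lra| |].
  - intros x Hx; assert (Hb : ball q0 d x).
    { apply Rabs_def1; unfold minus, plus, opp; simpl; lra. }
    generalize (Hd x Hb); intros H; apply Rabs_def2 in H.
    unfold minus, plus, opp, J in *; simpl in *; lra.
  - intros x _; apply (continuous_opp (fun x => J x t0)), CJ. }
assert (H2 : 0 <= RInt (fun x => opp (J x t0)) (q0 + e) (q0 + Q)).
{ apply RInt_ge_0; [lra | apply (ex_RInt_opp (V := R_CompleteNormedModule)), IJ |].
  intros x _; generalize (Hneg x t0); unfold J, opp; simpl; lra. }
rewrite (RInt_opp (V := R_CompleteNormedModule)) in H1 by apply IJ.
rewrite (RInt_opp (V := R_CompleteNormedModule)) in H2 by apply IJ.
generalize (RInt_Chasles (V := R_CompleteNormedModule) _ _ _ _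
              (IJ t0 q0 (q0 + e)) (IJ t0 (q0 + e) (q0 + Q))).
unfold plus, opp in *; simpl in *; lra.
Qed.
(** * Continuity rules *)

(** The rules are restated for real-valued functions in terms of the
    operations of R, so that they apply up to syntactic matching. *)
Lemma continuous_Rplus {U : UniformSpace} (f g : U -> R) x :
  continuous f x -> continuous g x -> continuous (fun y => f y + g y) x.
Proof. exact (continuous_plus f g x). Qed.

Lemma continuous_Rminus {U : UniformSpace} (f g : U -> R) x :
  continuous f x -> continuous g x -> continuous (fun y => f y - g y) x.
Proof. exact (continuous_minus f g x). Qed.

Lemma continuous_Ropp {U : UniformSpace} (f : U -> R) x :
  continuous f x -> continuous (fun y => - f y) x.
Proof. exact (continuous_opp f x). Qed.

Lemma continuous_Rmult {U : UniformSpace} (f g : U -> R) x :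
  continuous f x -> continuous g x -> continuous (fun y => f y * g y) x.
Proof. exact (continuous_mult f g x). Qed.

Lemma continuous_pow {U : UniformSpace} (f : U -> R) n x :
  continuous f x -> continuous (fun y => f y ^ n) x.
Proof.
intros H; induction n; [apply continuous_const | now apply continuous_Rmult].
Qed.

Lemma continuous_Rdiv {U : UniformSpace} (f g : U -> R) x :
  continuous f x -> continuous g x -> g x <> 0 -> continuous (fun y => f y / g y) x.
Proof.
intros Hf Hg H0; apply continuous_Rmult; [exact Hf|].
apply (continuous_comp g Rinv); [exact Hg | now apply continuous_Rinv].
Qed.

Lemma continuous_positive_part {U : UniformSpace} (f : U -> R) x :
  continuous f x -> continuous (fun y => Rmax 0 (f y)) x.
Proof.
intros Hf; apply continuous_ext with (f := fun y => (f y + Rabs (f y)) / 2).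
- intros y; unfold Rmax, Rabs; destruct Rle_dec, Rcase_abs; lra.
- apply continuous_Rmult; [|apply continuous_const].
  apply continuous_Rplus; [exact Hf|].
  apply (continuous_comp f Rabs); [exact Hf | apply continuous_Rabs].
Qed.

Lemma continuous_locally_positive {U : UniformSpace} (f : U -> R) x :
  continuous f x -> 0 < f x -> locally x (fun y => 0 < f y).
Proof. intros Hf H0; exact (Hf _ (open_gt 0 (f x) H0)). Qed.

Lemma continuous_phase (u : R -> R -> R) (x : R * (R * R)) :
  smooth u -> continuous (fun x : R * (R * R) => u (fst (snd x)) (snd (snd x))) x.
Proof.
intros Su; destruct x as [p z].
apply (continuous_comp snd (fun z : R * R => u (fst z) (snd z))).
- apply continuous_snd.
- now apply smooth_continuous.
Qed.

Lemma continuous_momentum (x : R * (R * R)) : continuous (fun x : R * (R * R) => fst x) x.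
Proof. destruct x; apply continuous_fst. Qed.

Ltac continuity_tac :=
  lazymatch goal with
  | |- continuous (fun _ => ?c) _ => apply continuous_const
  | |- continuous (fun z => @?f z + @?g z) _ =>
      apply (continuous_Rplus f g); continuity_tac
  | |- continuous (fun z => @?f z - @?g z) _ =>
      apply (continuous_Rminus f g); continuity_tac
  | |- continuous (fun z => - @?f z) _ => apply (continuous_Ropp f); continuity_tac
  | |- continuous (fun z => @?f z * @?g z) _ =>
      apply (continuous_Rmult f g); continuity_tac
  | |- continuous (fun z => @?f z / @?g z) _ =>
      apply (continuous_Rdiv f g); [continuity_tac | continuity_tac | idtac]
  | |- continuous (fun z => @?f z ^ ?n) _ => apply (continuous_pow f n); continuity_tac
  | |- continuous (fun z => Rmax 0 (@?f z)) _ =>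
      apply (continuous_positive_part f); continuity_tac
  | |- continuous (fun x => fst x) _ => apply continuous_momentum
  | |- continuous (fun x => ?u (fst (snd x)) (snd (snd x))) _ =>
      apply (continuous_phase u); assumption
  | |- continuous (fun z => ?u (fst z) (snd z)) _ =>
      first [assumption | apply (smooth_continuous u); assumption | idtac]
  | |- _ => try assumption
  end.

(** * Common periods *)

Lemma dq_shift_q (u : R -> R -> R) (Q : R) :
  (forall q t, u (q + Q) t = u q t) -> forall q t, dq u (q + Q) t = dq u q t.
Proof.
intros H q t; unfold dq, Derive; f_equal; apply Lim_ext; intros h.
replace (q + Q + h) with (q + h + Q) by ring; now rewrite !H.
Qed.

Lemma dq_shift_t (u : R -> R -> R) (T : R) :
  (forall q t, u q (t + T) = u q t) -> forall q t, dq u q (t + T) = dq u q t.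
Proof. intros H q t; apply Derive_ext; intros x; apply H. Qed.

Lemma dt_shift_q (u : R -> R -> R) (Q : R) :
  (forall q t, u (q + Q) t = u q t) -> forall q t, dt u (q + Q) t = dt u q t.
Proof. intros H q t; apply Derive_ext; intros x; apply H. Qed.

(** The increment of f over T does not depend on the base point, so f(x + n T)
    grows linearly in n; boundedness makes the increment zero. *)
Lemma periodic_of_periodic_derivative (f f' : R -> R) (T M : R) :
  (forall x, is_derive f x (f' x)) -> (forall x, f' (x + T) = f' x) ->
  (forall x, Rabs (f x) <= M) -> forall x, f (x + T) = f x.
Proof.
intros Df Pf Bf x.
pose (c := f (x + T) - f x).
assert (Hc : forall y, f (y + T) - f y = c).
{ assert (D0 : forall y, is_derive (fun y => f (y + T) - f y) y 0).
  { intros y; replace 0 with (f' (y + T) - f' y) by (rewrite Pf; ring).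
    apply (is_derive_minus (fun y => f (y + T)) f); [|apply Df].
    replace (f' (y + T)) with (scal 1 (f' (y + T))) by apply Rmult_1_l.
    apply (is_derive_comp f (fun y => y + T)); [apply Df|].
    auto_derive; trivial. }
  intros y; exact (is_derive_zero_const (fun y => f (y + T) - f y) D0 y x). }
assert (Hn : forall n : nat, f (x + INR n * T) = f x + INR n * c).
{ induction n as [|n IH]; [simpl; rewrite Rmult_0_l, Rplus_0_r; ring|].
  rewrite S_INR; replace (x + (INR n + 1) * T) with (x + INR n * T + T) by ring.
  generalize (Hc (x + INR n * T)); lra. }
destruct (Req_dec c 0) as [H0|H0]; [unfold c in H0; lra | exfalso].
assert (Hpos : 0 < Rabs c) by now apply Rabs_pos_lt.
destruct (INR_unbounded ((2 * M + 1) / Rabs c)) as [n Hgt].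
assert (H1 : 2 * M + 1 < INR n * Rabs c).
{ apply Rmult_lt_compat_r with (r := Rabs c) in Hgt; trivial.
  unfold Rdiv in Hgt; rewrite Rmult_assoc, Rinv_l, Rmult_1_r in Hgt; lra. }
generalize (Bf x) (Bf (x + INR n * T)) (Hn n); intros H2 H3 H4.
assert (H5 : INR n * Rabs c = Rabs (f (x + INR n * T) - f x)).
{ replace (f (x + INR n * T) - f x) with (INR n * c) by lra.
  rewrite Rabs_mult, (Rabs_pos_eq (INR n)); [trivial | apply pos_INR]. }
generalize (Rabs_triang (f (x + INR n * T)) (- f x)); rewrite Rabs_Ropp.
unfold Rminus in H5; lra.
Qed.

Record torus_solution (u v w : R -> R -> R) (Q T : R) : Prop := {
  sol_smooth_u : smooth u; sol_smooth_v : smooth v; sol_smooth_w : smooth w;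
  sol_Q_pos : 0 < Q; sol_T_pos : 0 < T;
  sol_uQ : forall q t, u (q + Q) t = u q t;
  sol_vQ : forall q t, v (q + Q) t = v q t;
  sol_wQ : forall q t, w (q + Q) t = w q t;
  sol_uT : forall q t, u q (t + T) = u q t;
  sol_vT : forall q t, v q (t + T) = v q t;
  sol_wT : forall q t, w q (t + T) = w q t;
  sol_dt_u : forall q t, dt u q t = - dq v q t;
  sol_dt_v : forall q t, dt v q t = 2 * u q t * dq u q t - dq w q t;
  sol_dt_w : forall q t, dt w q t = v q t * dq u q t
}.

Lemma biperiodic_bounded (u : R -> R -> R) :
  smooth u -> biperiodic u -> exists M, forall q t, Rabs (u q t) <= M.
Proof.
intros Hu [(Q & HQ & PQ) (T & HT & PT)].
apply (torus_bounded_2d u Q T); trivial.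
intros z; now apply smooth_continuous.
Qed.

(** The q-period of u is a period of v_q = - u_t, hence of v, and then of
    w_q = 2 u u_q - v_t, hence of w. Likewise the t-period of v is a period of
    u_t = - v_q and of w_t = v u_q. *)
Lemma common_periods (u v w : R -> R -> R) :
  smooth u -> smooth v -> smooth w ->
  biperiodic u -> biperiodic v -> biperiodic w ->
  quasilinear_system u v w -> exists Q T, torus_solution u v w Q T.
Proof.
intros Su Sv Sw Bu Bv Bw Hsys.
destruct (biperiodic_bounded u Su Bu) as [Mu HMu].
destruct (biperiodic_bounded v Sv Bv) as [Mv HMv].
destruct (biperiodic_bounded w Sw Bw) as [Mw HMw].
destruct Bu as [(Q & HQ & uQ) _], Bv as [_ (T & HT & vT)]; clear Bw.
assert (E := proj1 (quasilinear_systemE u v w) Hsys).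
assert (E1 : forall q t, dt u q t = - dq v q t)
  by (intros q t; destruct (E q t) as (? & ? & ?); lra).
assert (E2 : forall q t, dt v q t = 2 * u q t * dq u q t - dq w q t)
  by (intros q t; destruct (E q t) as (? & ? & ?); lra).
assert (E3 : forall q t, dt w q t = v q t * dq u q t)
  by (intros q t; destruct (E q t) as (? & ? & ?); lra).
assert (vQ : forall q t, v (q + Q) t = v q t).
{ intros q t.
  apply (periodic_of_periodic_derivative (fun x => v x t) (fun x => dq v x t) Q Mv); auto.
  - intros x; now apply smooth_is_derive_q.
  - intros x; generalize (E1 (x + Q) t) (E1 x t) (dt_shift_q u Q uQ x t); lra. }
assert (wQ : forall q t, w (q + Q) t = w q t).
{ intros q t.
  apply (periodic_of_periodic_derivative (fun x => w x t) (fun x => dq w x t) Q Mw); auto.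
  - intros x; now apply smooth_is_derive_q.
  - intros x; generalize (E2 (x + Q) t) (E2 x t).
    rewrite (dt_shift_q v Q vQ), (dq_shift_q u Q uQ), uQ; lra. }
assert (uT : forall q t, u q (t + T) = u q t).
{ intros q t.
  apply (periodic_of_periodic_derivative (u q) (dt u q) T Mu); auto.
  - intros x; now apply smooth_is_derive_t.
  - intros x; rewrite !E1; now rewrite (dq_shift_t v T vT). }
assert (wT : forall q t, w q (t + T) = w q t).
{ intros q t.
  apply (periodic_of_periodic_derivative (w q) (dt w q) T Mw); auto.
  - intros x; now apply smooth_is_derive_t.
  - intros x; rewrite !E3; now rewrite (dq_shift_t u T uT), vT. }
exists Q, T; constructor; auto.
Qed.

Lemma sol_dqt_u u v w Q T q t :
  torus_solution u v w Q T -> dt (dq u) q t = - dq (dq v) q t.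
Proof.
intros S; rewrite smooth_Schwarz by apply S.
unfold dq at 1; rewrite (Derive_ext _ (fun x => - dq v x t)) by (intros; apply S).
apply Derive_opp.
Qed.

Lemma sol_dqt_v u v w Q T q t :
  torus_solution u v w Q T ->
  dt (dq v) q t = 2 * dq u q t ^ 2 + 2 * u q t * dq (dq u) q t - dq (dq w) q t.
Proof.
intros S; rewrite smooth_Schwarz by apply S.
unfold dq at 1; rewrite (Derive_ext _ (fun x => 2 * u x t * dq u x t - dq w x t))
  by (intros; apply S).
assert (H1 := smooth_is_derive_q u q t (sol_smooth_u _ _ _ _ _ S)).
assert (H2 := smooth_is_derive_q (dq u) q t (smooth_dq _ (sol_smooth_u _ _ _ _ _ S))).
assert (H3 := smooth_is_derive_q (dq w) q t (smooth_dq _ (sol_smooth_w _ _ _ _ _ S))).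
apply is_derive_unique; auto_derive.
- repeat split; eexists; eassumption.
- change (Derive (fun x => u x t) q) with (dq u q t).
  change (Derive (fun x => dq u x t) q) with (dq (dq u) q t).
  change (Derive (fun x => dq w x t) q) with (dq (dq w) q t); ring.
Qed.

Lemma sol_dqt_w u v w Q T q t :
  torus_solution u v w Q T ->
  dt (dq w) q t = dq v q t * dq u q t + v q t * dq (dq u) q t.
Proof.
intros S; rewrite smooth_Schwarz by apply S.
unfold dq at 1; rewrite (Derive_ext _ (fun x => v x t * dq u x t)) by (intros; apply S).
assert (H1 := smooth_is_derive_q v q t (sol_smooth_v _ _ _ _ _ S)).
assert (H2 := smooth_is_derive_q (dq u) q t (smooth_dq _ (sol_smooth_u _ _ _ _ _ S))).
apply is_derive_unique; auto_derive.
- repeat split; eexists; eassumption.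
- change (Derive (fun x => v x t) q) with (dq v q t).
  change (Derive (fun x => dq u x t) q) with (dq (dq u) q t); ring.
Qed.
(** Replaces, after [auto_derive], the abstract derivative of a function by the
    value that H gives; the [change] removes an eta-expansion. *)
Ltac derive_rewrite H :=
  lazymatch type of H with is_derive ?f ?x ?l =>
    change (Derive (fun y : R => f y) x) with (Derive f x);
    rewrite (is_derive_unique f x l H)
  end.

(** * When a single Riemann invariant varies *)

(** Up to a negative factor, the discriminant of p^3 + 2 u p + v. *)
Definition discr (u v : R) : R := 32 * u ^ 3 + 27 * v ^ 2.

Lemma is_derive_weighted_slope (U V N : R -> R) (e U' V' N' : R) :
  is_derive U 0 U' -> is_derive V 0 V' -> is_derive N 0 N' ->
  is_derive (fun s => (e * discr (U s) (V s) * V s * N s) ^ 2) 0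
    (2 * (e * discr (U 0) (V 0) * V 0 * N 0) *
     (e * (96 * U 0 ^ 2 * U' + 54 * V 0 * V') * V 0 * N 0
      + e * discr (U 0) (V 0) * (V' * N 0 + V 0 * N'))).
Proof.
intros HU HV HN; unfold discr; auto_derive.
- repeat split; eexists; eassumption.
- derive_rewrite HU; derive_rewrite HV; derive_rewrite HN; ring.
Qed.

Lemma is_derive_slope_cubic (U V M N : R -> R) (x U' V' M' N' : R) :
  is_derive U x U' -> is_derive V x V' -> is_derive M x M' -> is_derive N x N' ->
  is_derive (fun s => N s ^ 3 + 2 * U s * N s * M s ^ 2 + V s * M s ^ 3) x
    (3 * N x ^ 2 * N' + 2 * U' * N x * M x ^ 2 + 2 * U x * N' * M x ^ 2
     + 4 * U x * N x * M x * M' + V' * M x ^ 3 + 3 * V x * M x ^ 2 * M').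
Proof.
intros HU HV HM HN; auto_derive.
- repeat split; eexists; eassumption.
- derive_rewrite HU; derive_rewrite HV; derive_rewrite HM; derive_rewrite HN; ring.
Qed.

Lemma is_derive_slope_product (P M N : R -> R) (x P' M' N' : R) :
  is_derive P x P' -> is_derive M x M' -> is_derive N x N' ->
  is_derive (fun s => P s * M s + N s ^ 2) x (P' * M x + P x * M' + 2 * N x * N').
Proof.
intros HP HM HN; auto_derive.
- repeat split; eexists; eassumption.
- derive_rewrite HP; derive_rewrite HM; derive_rewrite HN; ring.
Qed.

(** At a maximum of (e D v v_q)^2, where the state is constant along the
    direction (l, 1), the derivative of v_q in that direction must vanish; but it
    equals 3 v_q^2 / F_pp(l). The weight D v makes the maximised function vanish
    on the boundary of the region. The factor e selects the sign of D. *)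
Lemma one_invariant_trivial u v w Q T (e : R) :
  torus_solution u v w Q T ->
  (forall q t, 0 < e * discr (u q t) (v q t) -> v q t <> 0 ->
     exists l, l ^ 3 + 2 * u q t * l + v q t = 0 /\
       dq v q t = l * dq u q t /\ dq w q t = (2 * u q t + l ^ 2) * dq u q t) ->
  forall q t, 0 < e * discr (u q t) (v q t) -> v q t <> 0 ->
     dq u q t = 0 /\ dq v q t = 0 /\ dq w q t = 0.
Proof.
intros S Hone q1 t1 He1 Hv1.
assert (Su := sol_smooth_u _ _ _ _ _ S); assert (Sv := sol_smooth_v _ _ _ _ _ S).
assert (Sw := sol_smooth_w _ _ _ _ _ S).
assert (Sdu := smooth_dq u Su); assert (Sdv := smooth_dq v Sv).
assert (Sdtv := smooth_dt v Sv).
pose (f q t := (Rmax 0 (e * discr (u q t) (v q t)) * v q t * dq v q t) ^ 2).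
destruct (Req_dec (dq v q1 t1) 0) as [Hdv1|Hdv1].
{ destruct (Hone q1 t1 He1 Hv1) as (l & Hl & H1 & H2).
  rewrite Hdv1 in H1; symmetry in H1; apply Rmult_integral in H1.
  destruct H1 as [->|H1]; [exfalso; apply Hv1; lra|].
  rewrite H2, H1; repeat split; trivial; ring. }
exfalso.
destruct (torus_maximum_2d f Q T) as (q & t & Hmax).
{ apply S. } { apply S. }
{ intros z; unfold f, discr; continuity_tac. }
{ intros q t; unfold f.
  now rewrite (sol_uQ _ _ _ _ _ S), (sol_vQ _ _ _ _ _ S), (dq_shift_q v Q (sol_vQ _ _ _ _ _ S)). }
{ intros q t; unfold f.
  now rewrite (sol_uT _ _ _ _ _ S), (sol_vT _ _ _ _ _ S), (dq_shift_t v T (sol_vT _ _ _ _ _ S)). }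
assert (Hf0 : 0 < f q t).
{ apply Rlt_le_trans with (2 := Hmax q1 t1); unfold f.
  rewrite Rmax_right by lra; apply pow2_gt_0.
  apply Rmult_integral_contrapositive_currified; [|exact Hdv1].
  apply Rmult_integral_contrapositive_currified; [apply Rgt_not_eq; lra | exact Hv1]. }
assert (He : 0 < e * discr (u q t) (v q t)).
{ apply Rnot_le_lt; intros H; unfold f in Hf0; rewrite Rmax_left in Hf0 by lra; lra. }
assert (Hv : v q t <> 0) by (intros H; unfold f in Hf0; rewrite H in Hf0; lra).
assert (Hdv : dq v q t <> 0) by (intros H; unfold f in Hf0; rewrite H in Hf0; lra).
destruct (Hone q t He Hv) as (l & Hl & Hvl & Hwl).
assert (Hreg : forall z, continuous (fun z : R * R =>
          e * discr (u (fst z) (snd z)) (v (fst z) (snd z))) z)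
  by (intros z; unfold discr; continuity_tac).
(* Eliminating l, the slopes satisfy v_q^3 + 2 u v_q u_q^2 + v u_q^3 = 0 and
   v_t u_q + v_q^2 = 0 near (q, t). Their q-derivatives replace the derivative
   of l. *)
assert (Hloc : locally q (fun x => 0 < e * discr (u x t) (v x t) /\ v x t <> 0)).
{ apply filter_and.
  - apply (continuous_locally_positive (fun x => e * discr (u x t) (v x t))); trivial.
    exact (continuous2_slice_q (fun q t => e * discr (u q t) (v q t)) q t Hreg).
  - apply filter_imp with (P := fun x => 0 < v x t ^ 2).
    + intros x Hx H; rewrite H in Hx; lra.
    + apply (continuous_locally_positive (fun x => v x t ^ 2)).
      * apply continuous_pow, (continuous2_slice_q v).
        intros z; now apply smooth_continuous.
      * now apply pow2_gt_0. }
assert (G1 := is_derive_slope_cubic (fun x => u x t) (fun x => v x t)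
  (fun x => dq u x t) (fun x => dq v x t) q _ _ _ _
  (smooth_is_derive_q u q t Su) (smooth_is_derive_q v q t Sv)
  (smooth_is_derive_q (dq u) q t Sdu) (smooth_is_derive_q (dq v) q t Sdv)).
apply is_derive_loc_zero in G1.
2: { apply filter_imp with (2 := Hloc); intros x [Hx1 Hx2].
  destruct (Hone x t Hx1 Hx2) as (k & Hk & H1 & _); rewrite H1.
  transitivity (dq u x t ^ 3 * (k ^ 3 + 2 * u x t * k + v x t)); [ring|].
  rewrite Hk; ring. }
assert (G2 := is_derive_slope_product (fun x => dt v x t)
  (fun x => dq u x t) (fun x => dq v x t) q _ _ _
  (smooth_is_derive_q (dt v) q t Sdtv)
  (smooth_is_derive_q (dq u) q t Sdu) (smooth_is_derive_q (dq v) q t Sdv)).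
apply is_derive_loc_zero in G2.
2: { apply filter_imp with (2 := Hloc); intros x [Hx1 Hx2].
  destruct (Hone x t Hx1 Hx2) as (k & Hk & H1 & H2).
  rewrite (sol_dt_v _ _ _ _ _ S), H1, H2; ring. }
(* Along the direction (l, 1) only the slope of v varies. *)
pose (U s := u (q + s * l) (t + s * 1)).
pose (V s := v (q + s * l) (t + s * 1)).
pose (N s := dq v (q + s * l) (t + s * 1)).
assert (HU := smooth_is_derive_line u q t l 1 Su).
assert (HV := smooth_is_derive_line v q t l 1 Sv).
assert (HN := smooth_is_derive_line (dq v) q t l 1 Sdv).
fold U in HU; fold V in HV; fold N in HN.
assert (EU : U 0 = u q t) by (unfold U; rewrite !Rmult_0_l, !Rplus_0_r; trivial).
assert (EV : V 0 = v q t) by (unfold V; rewrite !Rmult_0_l, !Rplus_0_r; trivial).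
assert (EN : N 0 = dq v q t) by (unfold N; rewrite !Rmult_0_l, !Rplus_0_r; trivial).
assert (G3 := is_derive_weighted_slope U V N e _ _ _ HU HV HN).
apply is_derive_local_max in G3.
2: { assert (Hp : locally 0 (fun s => 0 < e * discr (U s) (V s))).
  { apply (continuous_locally_positive (fun s => e * discr (U s) (V s))).
    - assert (CU : continuous U 0) by (apply (ex_derive_continuous U); eexists; exact HU).
      assert (CV : continuous V 0) by (apply (ex_derive_continuous V); eexists; exact HV).
      unfold discr; continuity_tac.
    - now rewrite EU, EV. }
  apply filter_imp with (2 := Hp); intros s Hs; rewrite EU, EV, EN.
  generalize (Hmax (q + s * l) (t + s * 1)); unfold f.
  fold (U s) (V s) (N s); rewrite !Rmax_right by lra; trivial. }
rewrite EU, EV, EN in G3.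
rewrite (sol_dt_u _ _ _ _ _ S), (sol_dt_v _ _ _ _ _ S), smooth_Schwarz in G3 by trivial.
rewrite (sol_dt_v _ _ _ _ _ S) in G2.
rewrite Hvl, Hwl in *.
set (m := dq u q t) in *; set (a := u q t) in *; set (b := v q t) in *.
set (d := e * discr a b) in *.
assert (Hm : m <> 0) by (intros H; apply Hdv; rewrite H; ring).
assert (Hl0 : l <> 0) by (intros H; apply Hdv; rewrite H; ring).
set (n' := dq (dq v) q t) in *; set (m' := dq (dq u) q t) in *.
set (n'' := dq (dt v) q t) in *.
(* K1 is the equation for l_q, and K2 expresses v_qt. *)
assert (K1 : (3 * l ^ 2 + 2 * a) * (n' - l * m') = - 3 * l * m ^ 2).
{ apply Rmult_eq_reg_l with (m ^ 2); [|now apply pow_nonzero].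
  assert (Hb : b = - l ^ 3 - 2 * a * l) by lra; rewrite Hb in G1; lra. }
assert (K2 : n'' = l ^ 2 * m' - 2 * l * n').
{ apply Rmult_eq_reg_l with m; trivial; lra. }
assert (K3 : n'' + l * n' = 0).
{ assert (Hd : d <> 0) by (apply Rgt_not_eq; exact He).
  apply Rmult_eq_reg_l with (2 * (d * b * (l * m)) * (d * b)).
  - rewrite Rmult_0_r, <- G3; unfold d; ring.
  - clearbody d; repeat apply Rmult_integral_contrapositive_currified; trivial; lra. }
assert (K4 : l * (n' - l * m') = 0) by lra.
apply Rmult_integral in K4; destruct K4 as [K4|K4]; [now apply Hl0|].
rewrite K4 in K1; apply Hm.
assert (K5 : l * m ^ 2 = 0) by lra.
apply Rmult_integral in K5; destruct K5 as [K5|K5]; [now elim Hl0|].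
simpl in K5; rewrite Rmult_1_r in K5; apply Rmult_integral in K5; tauto.
Qed.
(** * Critical values at simple real roots *)

Definition Fp (u v p : R) : R := p ^ 3 + 2 * u * p + v.
Definition Fpp (u p : R) : R := 3 * p ^ 2 + 2 * u.
Definition Fq (a b c p : R) : R := a * p ^ 2 + b * p + c.

Lemma Fp_large (M u v p : R) :
  Rabs u <= M -> Rabs v <= M -> 2 * M + 2 <= Rabs p -> 1 <= Fp u v p ^ 2.
Proof.
intros Hu Hv; unfold Fp.
apply Rabs_le_between in Hu; apply Rabs_le_between in Hv.
unfold Rabs; destruct Rcase_abs; intros Hp.
- assert (- (p ^ 3 + 2 * u * p + v) >= 1).
  { assert (p ^ 2 + 2 * u >= 1) by nra. nra. }
  nra.
- assert (p ^ 3 + 2 * u * p + v >= 1).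
  { assert (p ^ 2 + 2 * u >= 1) by nra. nra. }
  nra.
Qed.

(** The functions of s are the values of p, u, v, u_q, v_q, w_q along a curve
    in phase space. *)
Lemma is_derive_penalised (P U V A B C : R -> R) (c P' U' V' A' B' C' : R) :
  is_derive P 0 P' -> is_derive U 0 U' -> is_derive V 0 V' ->
  is_derive A 0 A' -> is_derive B 0 B' -> is_derive C 0 C' ->
  is_derive (fun s => Fq (A s) (B s) (C s) (P s) ^ 2 * Fpp (U s) (P s)
                      - c * Fp (U s) (V s) (P s) ^ 2) 0
    (2 * Fq (A 0) (B 0) (C 0) (P 0) * Fpp (U 0) (P 0)
       * (Fq A' B' C' (P 0) + (2 * A 0 * P 0 + B 0) * P')
     + Fq (A 0) (B 0) (C 0) (P 0) ^ 2 * (6 * P 0 * P' + 2 * U')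
     - 2 * c * Fp (U 0) (V 0) (P 0)
       * (Fpp (U 0) (P 0) * P' + 2 * U' * P 0 + V')).
Proof.
intros HP HU HV HA HB HC; unfold Fq, Fpp, Fp; auto_derive.
- repeat split; eexists; eassumption.
- derive_rewrite HP; derive_rewrite HU; derive_rewrite HV.
  derive_rewrite HA; derive_rewrite HB; derive_rewrite HC; ring.
Qed.

(** Used to fix how small F_p^2 has to be at a maximum. *)
Lemma small_scale (K L : R) :
  0 <= K -> 0 < L -> exists d, 0 < d /\ forall x, x <= d -> K * x < L.
Proof.
intros HK HL; exists (L / (K + 1)); split; [apply Rdiv_lt_0_compat; lra|].
intros x Hx.
apply Rle_lt_trans with (K * (L / (K + 1))); [now apply Rmult_le_compat_l|].
assert (H : L / (K + 1) * (K + 1) = L) by (field; lra).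
assert (0 < L / (K + 1)) by (apply Rdiv_lt_0_compat; lra); lra.
Qed.

(** The derivative of F_q^2 F_pp - N F_p^2 along
    d/dt + p d/dq + (F_q / F_pp - u_q) d/dp. This field preserves F_p, so N drops
    out, and on F_p = 0 only the Riccati term 6 p F_q^3 / F_pp remains. In the
    left-hand side the t-derivatives are already replaced by means of the
    system; m', n', k' stand for u_qq, v_qq, w_qq. *)
Lemma transport_identity (u v a b c p m' n' k' N P' : R) :
  Fpp u p <> 0 -> P' = Fq a b c p / Fpp u p - a ->
  2 * Fq a b c p * Fpp u p
       * (Fq (p * m' + 1 * - n') (p * n' + 1 * (2 * a ^ 2 + 2 * u * m' - k'))
             (p * k' + 1 * (b * a + v * m')) p + (2 * a * p + b) * P')
     + Fq a b c p ^ 2 * (6 * p * P' + 2 * (p * a + 1 * - b))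
     - 2 * N * Fp u v p
       * (Fpp u p * P' + 2 * (p * a + 1 * - b) * p + (p * b + 1 * (2 * u * a - c)))
  = 2 * (Fq a b c p / Fpp u p) * (3 * p * Fq a b c p ^ 2 + Fpp u p ^ 2 * m' * Fp u v p).
Proof. intros H ->; unfold Fq, Fp, Fpp in *; field; exact H. Qed.

(** The function F_q^2 max(0, F_pp) - N F_p^2 - N max(0, u)^2 is maximised over
    the torus and a bounded range of p outside which F_p^2 is at least 1. For N
    large, F_p and max(0, u) are small at the maximum, while F_q and F_pp are
    bounded away from 0. If u < 0 there, the maximised function is
    differentiable and [transport_identity] gives a contradiction, since
    F_pp <= 3 p^2 keeps p away from 0. If u >= 0, then either v = 0, and F_p small
    makes p and F_pp small, or v <> 0, and F_q = 0 by the assumption on D > 0. *)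
Lemma real_invariant_constant u v w Q T :
  torus_solution u v w Q T ->
  (forall q t, 0 < discr (u q t) (v q t) -> v q t <> 0 ->
     dq u q t = 0 /\ dq v q t = 0 /\ dq w q t = 0) ->
  forall p q t, u q t <= 0 -> Fp (u q t) (v q t) p = 0 -> 0 < Fpp (u q t) p ->
    Fq (dq u q t) (dq v q t) (dq w q t) p = 0.
Proof.
intros S Hell p0 q0 t0 Hu0 HF0 Hpp0.
assert (Su := sol_smooth_u _ _ _ _ _ S); assert (Sv := sol_smooth_v _ _ _ _ _ S).
assert (Sw := sol_smooth_w _ _ _ _ _ S).
assert (Sdu := smooth_dq u Su); assert (Sdv := smooth_dq v Sv).
assert (Sdw := smooth_dq w Sw); assert (Sddu := smooth_dq _ Sdu).
assert (HQ := sol_Q_pos _ _ _ _ _ S); assert (HT := sol_T_pos _ _ _ _ _ S).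
assert (uQ := sol_uQ _ _ _ _ _ S); assert (uT := sol_uT _ _ _ _ _ S).
assert (vQ := sol_vQ _ _ _ _ _ S); assert (vT := sol_vT _ _ _ _ _ S).
assert (wQ := sol_wQ _ _ _ _ _ S); assert (wT := sol_wT _ _ _ _ _ S).
assert (duQ := dq_shift_q u Q uQ); assert (duT := dq_shift_t u T uT).
assert (dvQ := dq_shift_q v Q vQ); assert (dvT := dq_shift_t v T vT).
assert (dwQ := dq_shift_q w Q wQ); assert (dwT := dq_shift_t w T wT).
apply NNPP; intros Hne.
destruct (torus_bounded_2d u Q T HQ HT (fun z => smooth_continuous u z Su) uQ uT)
  as [Mu HMu].
destruct (torus_bounded_2d v Q T HQ HT (fun z => smooth_continuous v z Sv) vQ vT)
  as [Mv HMv].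
destruct (torus_bounded_2d (dq (dq u)) Q T HQ HT (fun z => smooth_continuous _ z Sddu)
  (dq_shift_q _ Q duQ) (dq_shift_t _ T duT)) as [K HK].
pose (M := Rmax Mu Mv).
assert (HuM : forall q t, Rabs (u q t) <= M)
  by (intros; eapply Rle_trans; [apply HMu | apply Rmax_l]).
assert (HvM : forall q t, Rabs (v q t) <= M)
  by (intros; eapply Rle_trans; [apply HMv | apply Rmax_r]).
assert (HM : 0 <= M) by (eapply Rle_trans; [apply Rabs_pos | apply (HuM 0 0)]).
clearbody M; clear Mu Mv HMu HMv.
pose (B := 2 * M + 2).
pose (Fq' x := Fq (dq u (fst (snd x)) (snd (snd x))) (dq v (fst (snd x)) (snd (snd x)))
                  (dq w (fst (snd x)) (snd (snd x))) (fst x)).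
pose (Fp' x := Fp (u (fst (snd x)) (snd (snd x))) (v (fst (snd x)) (snd (snd x))) (fst x)).
pose (Fpp' x := Fpp (u (fst (snd x)) (snd (snd x))) (fst x)).
pose (u' (x : R * (R * R)) := u (fst (snd x)) (snd (snd x))).
assert (Cu : forall x, continuous u' x) by (intros x; now apply continuous_phase).
assert (CFq : forall x, continuous Fq' x) by (intros x; unfold Fq', Fq; continuity_tac).
assert (CFp : forall x, continuous Fp' x) by (intros x; unfold Fp', Fp; continuity_tac).
assert (CFpp : forall x, continuous Fpp' x) by (intros x; unfold Fpp', Fpp; continuity_tac).
destruct (torus_bounded_3d (fun x => Fq' x ^ 2) B Q T) as [Cq HCq]; trivial.
{ unfold B; lra. }
{ intros x; apply continuous_pow, CFq. }
{ intros; unfold Fq'; simpl; now rewrite duQ, dvQ, dwQ. }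
{ intros; unfold Fq'; simpl; now rewrite duT, dvT, dwT. }
destruct (torus_bounded_3d (fun x => Fq' x ^ 2 * Rmax 0 (Fpp' x)) B Q T) as [Cw HCw]; trivial.
{ unfold B; lra. }
{ intros x; apply continuous_Rmult; [apply continuous_pow, CFq|].
  apply continuous_positive_part, CFpp. }
{ intros; unfold Fq', Fpp'; simpl; now rewrite duQ, dvQ, dwQ, uQ. }
{ intros; unfold Fq', Fpp'; simpl; now rewrite duT, dvT, dwT, uT. }
pose (C1 := 3 * B ^ 2 + 2 * M).
assert (HC1 : forall p q t, - B <= p <= B -> Fpp' (p, (q, t)) <= C1).
{ intros p q t Hp; unfold Fpp', Fpp, C1; simpl fst; simpl snd.
  generalize (proj1 (Rabs_le_between _ _) (HuM q t)); intros Hu; nra. }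
assert (Hp0 : - B <= p0 <= B).
{ destruct (Rle_or_lt B (Rabs p0)) as [H|H].
  - generalize (Fp_large M _ _ p0 (HuM q0 t0) (HvM q0 t0) H); rewrite HF0; lra.
  - apply Rabs_def2 in H; lra. }
pose (w0 := Fq' (p0, (q0, t0)) ^ 2 * Fpp' (p0, (q0, t0))).
assert (Hw0 : 0 < w0) by (apply Rmult_lt_0_compat; [apply pow2_gt_0; exact Hne | exact Hpp0]).
assert (Hw0C : w0 <= Cw).
{ apply Rle_trans with (2 := HCw p0 q0 t0 Hp0).
  rewrite Rmax_right by (apply Rlt_le; exact Hpp0); unfold w0; lra. }
assert (HCq0 : 0 < Cq).
{ apply Rlt_le_trans with (2 := HCq p0 q0 t0 Hp0); apply pow2_gt_0; exact Hne. }
assert (HC10 : 0 < C1) by (apply Rlt_le_trans with (1 := Hpp0); apply (HC1 p0 q0 t0 Hp0)).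
(* Lower bounds for F_pp and F_q^2 wherever F_q^2 F_pp >= w0. *)
pose (k := w0 / Cq).
assert (Hk : 0 < k) by (apply Rdiv_lt_0_compat; trivial).
pose (l := w0 / C1).
assert (Hl : 0 < l) by (apply Rdiv_lt_0_compat; trivial).
(* d bounds F_p^2 and max(0, u)^2 at the maximum. The requirements are, in this
   order: u < k / 4; p^6 < k^3 / 216 when u >= 0 and v = 0; and the u_qq term
   of the transport identity is smaller than the Riccati term. *)
destruct (small_scale 16 (k ^ 2)) as (d1 & Hd1 & Hs1); [lra | apply pow_lt; exact Hk |].
destruct (small_scale 216 (k ^ 3)) as (d2 & Hd2 & Hs2); [lra | apply pow_lt; exact Hk |].
destruct (small_scale (C1 ^ 4 * K ^ 2) (3 * k * l ^ 2)) as (d3 & Hd3 & Hs3).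
{ apply Rmult_le_pos; [apply pow_le; lra | apply pow2_ge_0]. }
{ apply Rmult_lt_0_compat; [lra | now apply pow_lt]. }
pose (d := Rmin (1 / 2) (Rmin d1 (Rmin d2 d3))).
assert (Hd : 0 < d) by (unfold d; repeat apply Rmin_pos; trivial; lra).
assert (Hdd : d <= 1 / 2 /\ d <= d1 /\ d <= d2 /\ d <= d3).
{ unfold d; repeat split; [apply Rmin_l | | |];
   repeat first [apply Rle_refl | apply Rmin_l
                | eapply Rle_trans; [apply Rmin_r|]]. }
clearbody d; destruct Hdd as (Hda & Hdb & Hdc & Hde).
pose (N := Cw / d).
assert (HN : 0 < N) by (apply Rdiv_lt_0_compat; lra).
assert (HNd : forall x, N * x <= Cw -> x <= d).
{ intros x Hx; apply Rmult_le_reg_l with (1 := HN); replace (N * d) with Cw; trivial.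
  unfold N; field; lra. }
pose (Phi x := Fq' x ^ 2 * Rmax 0 (Fpp' x) - N * Fp' x ^ 2 - N * Rmax 0 (u' x) ^ 2).
destruct (torus_maximum Phi B Q T) as (p & q & t & Hp & Hmax); trivial.
{ unfold B; lra. }
{ intros x; unfold Phi; apply continuous_Rminus; [apply continuous_Rminus|].
  - apply continuous_Rmult; [apply continuous_pow, CFq|].
    apply continuous_positive_part, CFpp.
  - apply continuous_Rmult; [apply continuous_const | apply continuous_pow, CFp].
  - apply continuous_Rmult; [apply continuous_const|].
    apply continuous_pow, continuous_positive_part, Cu. }
{ intros; unfold Phi, Fq', Fpp', Fp', u'; simpl; now rewrite duQ, dvQ, dwQ, uQ, vQ. }
{ intros; unfold Phi, Fq', Fpp', Fp', u'; simpl; now rewrite duT, dvT, dwT, uT, vT. }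
assert (HPhi : w0 <= Phi (p, (q, t))).
{ apply Rle_trans with (2 := Hmax p0 q0 t0 Hp0); unfold Phi.
  rewrite (Rmax_right 0 (Fpp' _)) by (apply Rlt_le; exact Hpp0).
  rewrite (Rmax_left 0 (u' _)) by exact Hu0.
  unfold Fp'; simpl fst; simpl snd; rewrite HF0; unfold w0; lra. }
generalize (HCw p q t Hp); intros HW.
assert (Hsq1 : 0 <= N * Fp' (p, (q, t)) ^ 2)
  by (apply Rmult_le_pos; [lra | apply pow2_ge_0]).
assert (Hsq2 : 0 <= N * Rmax 0 (u' (p, (q, t))) ^ 2)
  by (apply Rmult_le_pos; [lra | apply pow2_ge_0]).
unfold Phi in HPhi.
assert (HFp : Fp' (p, (q, t)) ^ 2 <= d) by (apply HNd; lra).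
assert (Hup : Rmax 0 (u' (p, (q, t))) ^ 2 <= d) by (apply HNd; lra).
assert (HW' : w0 <= Fq' (p, (q, t)) ^ 2 * Rmax 0 (Fpp' (p, (q, t)))) by lra.
assert (HFpp : 0 < Fpp' (p, (q, t))).
{ apply Rnot_le_lt; intros H; rewrite Rmax_left in HW' by exact H; lra. }
rewrite Rmax_right in HW' by lra.
assert (Hkpp : k <= Fpp' (p, (q, t))).
{ apply Rmult_le_reg_l with (1 := HCq0); replace (Cq * k) with w0 by (unfold k; field; lra).
  apply Rle_trans with (1 := HW'), Rmult_le_compat_r; [lra | now apply HCq]. }
assert (Hlq : l <= Fq' (p, (q, t)) ^ 2).
{ apply Rmult_le_reg_l with (1 := HC10); replace (C1 * l) with w0 by (unfold l; field; lra).
  apply Rle_trans with (1 := HW'); rewrite Rmult_comm.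
  apply Rmult_le_compat_r; [apply pow2_ge_0 | now apply HC1]. }
assert (HpB : Rabs p < B).
{ apply Rnot_le_lt; intros H.
  generalize (Fp_large M _ _ p (HuM q t) (HvM q t) H); unfold Fp' in HFp; simpl in HFp |- *; lra. }
unfold Fp', Fpp', Fq', u' in *; simpl fst in *; simpl snd in *.
destruct (Rle_or_lt 0 (u q t)) as [Hu|Hu].
- rewrite Rmax_right in Hup by exact Hu.
  destruct (Req_dec (v q t) 0) as [Hv|Hv].
  + unfold Fp, Fpp in *; rewrite Hv in HFp.
    assert (A1 : 16 * u q t ^ 2 < k ^ 2) by (apply Hs1; lra).
    assert (A2 : 4 * u q t < k) by nra.
    assert (A3 : k < 6 * p ^ 2) by lra.
    assert (A4 : k ^ 3 <= (6 * p ^ 2) ^ 3) by (apply pow_incr; lra).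
    assert (A5 : 216 * (p ^ 3 + 2 * u q t * p + 0) ^ 2 < k ^ 3) by (apply Hs2; lra).
    assert (A6 : (p ^ 3) ^ 2 <= (p ^ 3 + 2 * u q t * p + 0) ^ 2).
    { replace ((p ^ 3 + 2 * u q t * p + 0) ^ 2)
        with ((p ^ 3) ^ 2 + 4 * u q t * (p ^ 2) ^ 2 + 4 * (u q t * p) ^ 2) by ring.
      assert (0 <= 4 * u q t * (p ^ 2) ^ 2)
        by (apply Rmult_le_pos; [lra | apply pow2_ge_0]).
      generalize (pow2_ge_0 (u q t * p)); lra. }
    replace ((6 * p ^ 2) ^ 3) with (216 * (p ^ 3) ^ 2) in A4 by ring; lra.
  + destruct (Hell q t) as (H1 & H2 & H3); trivial.
    { unfold discr; assert (0 < v q t ^ 2) by now apply pow2_gt_0.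
      assert (0 <= u q t ^ 3) by now apply pow_le. lra. }
    rewrite H1, H2, H3 in Hlq; unfold Fq in Hlq; lra.
- (* The maximised function is constant to first order along the field of
     [transport_identity]. *)
  set (P' := Fq (dq u q t) (dq v q t) (dq w q t) p / Fpp (u q t) p - dq u q t).
  pose (P s := p + s * P'); pose (X s := q + s * p); pose (Y s := t + s * 1).
  assert (HP : is_derive P 0 P') by (unfold P; auto_derive; trivial; ring).
  assert (HG := is_derive_penalised P _ _ _ _ _ N _ _ _ _ _ _ HP
    (smooth_is_derive_line u q t p 1 Su) (smooth_is_derive_line v q t p 1 Sv)
    (smooth_is_derive_line (dq u) q t p 1 Sdu) (smooth_is_derive_line (dq v) q t p 1 Sdv)
    (smooth_is_derive_line (dq w) q t p 1 Sdw)); cbv beta in HG.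
  apply is_derive_local_max in HG.
  2: { pose (U s := u (q + s * p) (t + s * 1)).
    assert (CP : continuous P 0) by (apply (ex_derive_continuous P); eexists; exact HP).
    assert (CU : continuous U 0).
    { apply (ex_derive_continuous U); eexists; exact (smooth_is_derive_line u q t p 1 Su). }
    assert (EP : P 0 = p) by (unfold P; ring).
    assert (EU : U 0 = u q t) by (unfold U; now rewrite !Rmult_0_l, !Rplus_0_r).
    assert (L1 : locally 0 (fun s => 0 < 3 * P s ^ 2 + 2 * U s)).
    { apply (continuous_locally_positive (fun s => 3 * P s ^ 2 + 2 * U s)).
      - continuity_tac.
      - rewrite EP, EU; exact HFpp. }
    assert (L2 : locally 0 (fun s => 0 < - U s)).
    { apply (continuous_locally_positive (fun s => - U s)); [continuity_tac|].
      rewrite EU; lra. }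
    assert (L3 : locally 0 (fun s => 0 < B ^ 2 - P s ^ 2)).
    { apply (continuous_locally_positive (fun s => B ^ 2 - P s ^ 2)); [continuity_tac|].
      rewrite EP, <- (pow2_abs p); generalize (Rabs_pos p); nra. }
    generalize (filter_and _ _ L1 (filter_and _ _ L2 L3)); clear L1 L2 L3.
    apply filter_imp; intros s (G1 & G2 & G3).
    assert (HPs : - B <= P s <= B) by (unfold B in *; split; nra).
    generalize (Hmax (P s) (q + s * p) (t + s * 1) HPs); unfold Phi; simpl fst; simpl snd.
    fold (U s).
    rewrite (Rmax_right 0 (Fpp (U s) (P s))) by (apply Rlt_le; exact G1).
    rewrite (Rmax_left 0 (U s)) by lra.
    rewrite (Rmax_right 0 (Fpp (u q t) p)) by (apply Rlt_le; exact HFpp).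
    rewrite (Rmax_left 0 (u q t)) by lra.
    rewrite EP, !Rmult_0_l, !Rplus_0_r; lra. }
  unfold P in HG; rewrite !Rmult_0_l, !Rplus_0_r in HG.
  rewrite (sol_dt_u _ _ _ _ _ S), (sol_dt_v _ _ _ _ _ S), (sol_dqt_u _ _ _ _ _ _ _ S),
    (sol_dqt_v _ _ _ _ _ _ _ S), (sol_dqt_w _ _ _ _ _ _ _ S) in HG.
  rewrite transport_identity in HG by (reflexivity || lra).
  set (f := Fq (dq u q t) (dq v q t) (dq w q t) p) in *.
  set (g := Fpp (u q t) p) in *; set (h := Fp (u q t) (v q t) p) in *.
  set (m' := dq (dq u) q t) in *.
  assert (Hf : f <> 0) by (intros H; rewrite H in Hlq; lra).
  assert (HG1 : 3 * p * f ^ 2 = - (g ^ 2 * m' * h)).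
  { apply Rmult_integral in HG; destruct HG as [HG|HG]; [|lra].
    exfalso; apply Rmult_integral in HG; destruct HG as [HG|HG]; [lra|].
    apply Rmult_integral in HG; destruct HG as [HG|HG]; [now apply Hf|].
    revert HG; apply Rinv_neq_0_compat; lra. }
  assert (HG2 : 9 * p ^ 2 * (f ^ 2) ^ 2 = g ^ 4 * m' ^ 2 * h ^ 2).
  { replace (9 * p ^ 2 * (f ^ 2) ^ 2) with ((3 * p * f ^ 2) ^ 2) by ring.
    rewrite HG1; ring. }
  assert (A1 : 3 * k * l ^ 2 <= 9 * p ^ 2 * (f ^ 2) ^ 2).
  { apply Rmult_le_compat; [lra | apply pow2_ge_0 | |].
    - unfold g, Fpp in Hkpp; lra.
    - apply pow_incr; lra. }
  assert (A2 : C1 ^ 4 * K ^ 2 * h ^ 2 < 3 * k * l ^ 2) by (apply Hs3; lra).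
  assert (A3 : g ^ 4 * m' ^ 2 * h ^ 2 <= C1 ^ 4 * K ^ 2 * h ^ 2).
  { apply Rmult_le_compat_r; [apply pow2_ge_0|].
    apply Rmult_le_compat; [apply pow_le; lra | apply pow2_ge_0 | |].
    - apply pow_incr; split; [lra | now apply HC1].
    - rewrite <- (pow2_abs m'); apply pow_incr; split; [apply Rabs_pos | apply HK]. }
  lra.
Qed.
(** * A real root of the cubic and its dependence on the coefficients *)

Lemma cubic_root_exists (u v : R) :
  { p : R | Rabs p <= 1 + 2 * Rabs u + Rabs v /\ Fp u v p = 0 }.
Proof.
pose (B := 1 + 2 * Rabs u + Rabs v).
assert (HB : 1 <= B) by (unfold B; generalize (Rabs_pos u) (Rabs_pos v); lra).
assert (Hu := proj1 (Rabs_le_between u (Rabs u)) (Rle_refl _)).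
assert (Hv := proj1 (Rabs_le_between v (Rabs v)) (Rle_refl _)).
assert (Hpos : 0 <= B ^ 3 - 2 * Rabs u * B - Rabs v).
{ assert (B <= B ^ 2) by nra.
  assert (1 + Rabs v <= B ^ 2 - 2 * Rabs u) by (unfold B at 1 in H; lra).
  assert (0 <= (B - 1) * (B ^ 2 - 2 * Rabs u)) by (generalize (Rabs_pos v); nra).
  lra. }
destruct (IVT_cor (Fp u v) (- B) B) as [p [Hp H0]].
- unfold Fp; intros p; apply continuity_pt_filterlim.
  apply (ex_derive_continuous (fun p => p ^ 3 + 2 * u * p + v)); auto_derive; trivial.
- lra.
- unfold Fp; assert (Fp u v B >= 0) by (unfold Fp; nra).
  assert (- Fp u v (- B) >= 0) by (unfold Fp; nra).
  unfold Fp in *; nra.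
- exists p; split; [|exact H0]. apply Rabs_le_between; fold B; lra.
Qed.

(** An arbitrary choice of real root; for D > 0 there is only one. *)
Definition real_root (u v : R) : R := proj1_sig (cubic_root_exists u v).

Lemma real_rootP (u v : R) : Fp u v (real_root u v) = 0.
Proof. exact (proj2 (proj2_sig (cubic_root_exists u v))). Qed.

Lemma real_root_bound (u v : R) : Rabs (real_root u v) <= 1 + 2 * Rabs u + Rabs v.
Proof. exact (proj1 (proj2_sig (cubic_root_exists u v))). Qed.

(** If l is a real root, the other two are - l / 2 +- i sqrt (im2 u l). *)
Definition im2 (u l : R) : R := 2 * u + 3 / 4 * l ^ 2.

Lemma discr_factor (u v l : R) :
  Fp u v l = 0 -> discr u v = 4 * im2 u l * Fpp u l ^ 2.
Proof.
unfold Fp, discr, im2, Fpp; intros H.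
assert (E : v = - l ^ 3 - 2 * u * l) by lra; rewrite E; field.
Qed.

(** The second factor is at least half of [im2 u l] for u' near u, whichever
    root l' is. This gives continuity of the root without any uniqueness
    argument, and its derivative. *)
Lemma root_increment (u v l u' v' l' : R) :
  Fp u v l = 0 -> Fp u' v' l' = 0 ->
  (l' - l) * ((l' + l / 2) ^ 2 + 3 / 4 * l ^ 2 + 2 * u') =
  - (2 * l * (u' - u) + (v' - v)).
Proof.
unfold Fp; intros H H'.
assert (E : v = - l ^ 3 - 2 * u * l) by lra.
assert (E' : v' = - l' ^ 3 - 2 * u' * l') by lra.
rewrite E, E'; field.
Qed.

Lemma continuous_root {U : UniformSpace} (f g r : U -> R) (x : U) :
  (forall y, Fp (f y) (g y) (r y) = 0) -> 0 < im2 (f x) (r x) ->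
  continuous f x -> continuous g x -> continuous r x.
Proof.
intros Hr Hx Cf Cg.
apply filterlim_locally; intros eps.
pose (c := im2 (f x) (r x)).
pose (phi y := 2 * r x * (f y - f x) + (g y - g x)).
assert (Cphi : continuous phi x) by (unfold phi; continuity_tac).
assert (L1 : locally x (fun y => 0 < 2 * f y + 3 / 4 * r x ^ 2 - c / 2)).
{ apply (continuous_locally_positive (fun y => 2 * f y + 3 / 4 * r x ^ 2 - c / 2)).
  - continuity_tac.
  - unfold c, im2 in *; lra. }
assert (L2 : locally x (fun y => 0 < (eps * (c / 2)) ^ 2 - phi y ^ 2)).
{ apply (continuous_locally_positive (fun y => (eps * (c / 2)) ^ 2 - phi y ^ 2)).
  - continuity_tac.
  - replace (phi x) with 0 by (unfold phi; ring).
    assert (0 < eps * (c / 2)) by (apply Rmult_lt_0_compat; [apply cond_pos | unfold c; lra]).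
    assert (0 < (eps * (c / 2)) ^ 2) by now apply pow_lt.
    lra. }
generalize (filter_and _ _ L1 L2); apply filter_imp; intros y [H1 H2].
assert (H3 := root_increment _ _ _ _ _ _ (Hr x) (Hr y)).
fold (phi y) in H3.
set (D := (r y + r x / 2) ^ 2 + 3 / 4 * r x ^ 2 + 2 * f y) in *.
assert (HD : c / 2 < D) by (generalize (pow2_ge_0 (r y + r x / 2)); unfold D; lra).
assert (Hc : 0 < c / 2) by (unfold c; lra).
assert (He := cond_pos eps).
assert (H4 : ((r y - r x) * D) ^ 2 < (eps * (c / 2)) ^ 2)
  by (rewrite H3; replace ((- phi y) ^ 2) with (phi y ^ 2) by ring; lra).
assert (H5 : (Rabs (r y - r x) * D) ^ 2 < (eps * (c / 2)) ^ 2).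
{ rewrite Rpow_mult_distr, pow2_abs, <- Rpow_mult_distr; exact H4. }
change (Rabs (r y - r x) < eps).
apply (Rmult_lt_reg_r D); [lra|].
assert (H6 : Rabs (r y - r x) * D < eps * (c / 2)).
{ apply Rnot_le_lt; intros H; apply (Rlt_irrefl ((eps * (c / 2)) ^ 2)).
  apply Rle_lt_trans with (2 := H5); apply pow_incr; split; [|exact H].
  apply Rmult_le_pos; lra. }
apply (Rlt_trans _ _ _ H6), Rmult_lt_compat_l; trivial.
Qed.

Lemma derivable_pt_lim_quotient (f : R -> R) (x l : R) :
  derivable_pt_lim f x l <->
  filterlim (fun h => (f (x + h) - f x) / h) (locally' 0) (locally l).
Proof.
split; intros H.
- apply filterlim_locally; intros eps.
  destruct (H eps (cond_pos eps)) as [d Hd]; exists d; intros h Hh Hne.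
  apply Hd; trivial; revert Hh.
  unfold ball; simpl; unfold AbsRing_ball, minus, plus, opp, abs; simpl.
  now rewrite Ropp_0, Rplus_0_r.
- intros eps He.
  destruct (proj1 (filterlim_locally _ _) H (mkposreal eps He)) as [d Hd].
  exists d; intros h Hne Hh; apply Hd; trivial.
  unfold ball; simpl; unfold AbsRing_ball, minus, plus, opp, abs; simpl.
  now rewrite Ropp_0, Rplus_0_r.
Qed.

(** As f vanishes at x, the difference quotient is that of f times g(y). *)
Lemma is_derive_factor (f g : R -> R) (x f' : R) :
  is_derive f x f' -> f x = 0 -> continuous g x ->
  is_derive (fun y => f y * g y) x (f' * g x).
Proof.
intros Df Hf Cg; apply is_derive_Reals, derivable_pt_lim_quotient.
apply is_derive_Reals, derivable_pt_lim_quotient in Df.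
apply filterlim_ext with (f := fun h => mult ((f (x + h) - f x) / h) (g (x + h))).
{ intros h; rewrite Hf; unfold mult, Rdiv; simpl; ring. }
apply (filterlim_comp_2 (G := locally f') (H := locally (g x))
        (fun h => (f (x + h) - f x) / h) (fun h => g (x + h)) mult).
- exact Df.
- apply (filterlim_filter_le_1 (F := locally (0 : R))).
  { intros P HP; revert HP; unfold locally', within; apply filter_imp; auto. }
  assert (C : continuous (fun h => g (x + h)) 0).
  { apply (continuous_comp (fun h => x + h) g).
    - apply continuous_Rplus; [apply continuous_const | apply continuous_id].
    - rewrite Rplus_0_r; exact Cg. }
  unfold continuous in C; rewrite Rplus_0_r in C; exact C.
- apply (filterlim_mult f' (g x)).
Qed.

Lemma is_derive_root (f g r : R -> R) (x f' g' : R) :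
  (forall y, Fp (f y) (g y) (r y) = 0) -> 0 < im2 (f x) (r x) ->
  is_derive f x f' -> is_derive g x g' ->
  is_derive r x (- (2 * r x * f' + g') / Fpp (f x) (r x)).
Proof.
intros Hr Hx Df Dg.
assert (Cf : continuous f x) by (apply (ex_derive_continuous f); now exists f').
assert (Cg : continuous g x) by (apply (ex_derive_continuous g); now exists g').
assert (Cr := continuous_root f g r x Hr Hx Cf Cg).
pose (D y := (r y + r x / 2) ^ 2 + 3 / 4 * r x ^ 2 + 2 * f y).
pose (phi y := - (2 * r x * (f y - f x) + (g y - g x))).
assert (CD : continuous D x) by (unfold D; continuity_tac; lra).
assert (ED : D x = Fpp (f x) (r x)) by (unfold D, Fpp; field).
assert (HD : 0 < D x).
{ rewrite ED; unfold Fpp; unfold im2 in Hx; generalize (pow2_ge_0 (r x)); lra. }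
assert (Hk : is_derive (fun y => phi y * / D y) x (- (2 * r x * f' + g') * / D x)).
{ apply (is_derive_factor phi (fun y => / D y)).
  - unfold phi; auto_derive.
    + repeat split; eexists; eassumption.
    + derive_rewrite Df; derive_rewrite Dg; ring.
  - unfold phi; ring.
  - apply (continuous_comp D Rinv); [exact CD | apply continuous_Rinv; lra]. }
rewrite ED in Hk.
assert (Hk2 : is_derive (fun y => r x + phi y * / D y) x
               (- (2 * r x * f' + g') / Fpp (f x) (r x))).
{ replace (- (2 * r x * f' + g') / Fpp (f x) (r x))
    with (0 + - (2 * r x * f' + g') * / Fpp (f x) (r x)) by (unfold Rdiv; ring).
  apply (is_derive_plus (fun _ => r x) (fun y => phi y * / D y)); [|exact Hk].
  apply (is_derive_const (r x)). }
apply is_derive_ext_loc with (2 := Hk2).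
generalize (continuous_locally_positive D x CD HD); apply filter_imp; intros y Hy.
assert (E := root_increment _ _ _ _ _ _ (Hr x) (Hr y)).
fold (D y) in E; fold (phi y) in E; change (r x + phi y * / D y = r y).
rewrite <- E; field; lra.
Qed.
(** * The complex critical value *)

(** The imaginary part of F at the nonreal root with positive imaginary part,
    where l is the real root. *)
Definition crit_im (u l : R) : R := - l * sqrt (im2 u l) ^ 3.

(** The real part of a z^2 + b z + c at z = - l / 2 + i sqrt (im2 u l). With
    (a, b, c) = (u_q, v_q, w_q) it is the q-derivative of the real part of the
    critical value, and similarly for t. *)
Definition reFq (u l a b c : R) : R := c - l / 2 * b - (l ^ 2 / 2 + 2 * u) * a.

(** An odd nondecreasing C^1 function that vanishes for x^2 <= eps. *)
Definition cutoff (eps x : R) : R := x * Rmax 0 (x ^ 2 - eps) ^ 2.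

Definition cutoff' (eps x : R) : R :=
  Rmax 0 (x ^ 2 - eps) ^ 2 + 4 * x ^ 2 * Rmax 0 (x ^ 2 - eps).

(** The derivative of cutoff (crit_im u l) * reFq u l a b c when u, v, a, b, c
    have derivatives u', v', a', b', c'. The derivative of l is
    - (2 l u' + v') / F_pp(l). *)
Definition flux' (eps u l a b c u' v' a' b' c' : R) : R :=
  cutoff' eps (crit_im u l) * (sqrt (im2 u l) * (v' - l * u')) * reFq u l a b c
  + cutoff eps (crit_im u l)
    * (reFq u l a' b' c' - - (2 * l * u' + v') / Fpp u l / 2 * b
       - (l * (- (2 * l * u' + v') / Fpp u l) + 2 * u') * a).

Lemma is_derive_positive_part_sqr (x : R) :
  is_derive (fun y => Rmax 0 y ^ 2) x (2 * Rmax 0 x).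
Proof.
destruct (Rtotal_order x 0) as [Hx|[->|Hx]].
- rewrite Rmax_left by lra; rewrite Rmult_0_r.
  apply is_derive_ext_loc with (f := fun _ => 0);
    [|apply (is_derive_const (V := R_NormedModule) 0)].
  generalize (open_lt 0 x Hx); apply filter_imp; intros y Hy.
  change (0 = Rmax 0 y ^ 2); rewrite Rmax_left by lra; ring.
- rewrite Rmax_left by lra; rewrite Rmult_0_r.
  apply is_derive_Reals; intros eps He; exists (mkposreal eps He); intros h Hh Hlt.
  simpl in Hlt; rewrite Rplus_0_l, (Rmax_left 0 0) by lra.
  unfold Rmax; destruct Rle_dec.
  + replace ((h ^ 2 - 0 ^ 2) / h - 0) with h by (field; trivial); trivial.
  + replace ((0 ^ 2 - 0 ^ 2) / h - 0) with 0 by (field; trivial); rewrite Rabs_R0; trivial.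
- rewrite Rmax_right by lra.
  apply is_derive_ext_loc with (f := fun y => y ^ 2); [|auto_derive; trivial; ring].
  generalize (open_gt 0 x Hx); apply filter_imp; intros y Hy.
  rewrite Rmax_right by lra; trivial.
Qed.

Lemma is_derive_cutoff (eps x : R) : is_derive (cutoff eps) x (cutoff' eps x).
Proof.
assert (H : is_derive (fun y => Rmax 0 (y ^ 2 - eps) ^ 2) x
              ((2 * x) * (2 * Rmax 0 (x ^ 2 - eps)))).
{ apply (is_derive_comp (fun y => Rmax 0 y ^ 2) (fun y => y ^ 2 - eps)).
  - apply is_derive_positive_part_sqr.
  - auto_derive; trivial; ring. }
unfold cutoff, cutoff'.
replace (Rmax 0 (x ^ 2 - eps) ^ 2 + 4 * x ^ 2 * Rmax 0 (x ^ 2 - eps))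
  with (1 * Rmax 0 (x ^ 2 - eps) ^ 2 + x * ((2 * x) * (2 * Rmax 0 (x ^ 2 - eps)))) by ring.
apply (is_derive_mult (fun y => y) (fun y => Rmax 0 (y ^ 2 - eps) ^ 2)).
- apply (is_derive_id x).
- exact H.
- exact Rmult_comm.
Qed.

(** In closed form, because F_p vanishes at the nonreal root: the derivative is
    the imaginary part of u' z^2 + v' z + w' there. *)
Lemma is_derive_crit_im (U V L : R -> R) (x U' V' : R) :
  (forall y, Fp (U y) (V y) (L y) = 0) -> 0 < im2 (U x) (L x) ->
  is_derive U x U' -> is_derive V x V' ->
  is_derive (fun s => crit_im (U s) (L s)) x
    (sqrt (im2 (U x) (L x)) * (V' - L x * U')).
Proof.
intros HL Hx DU DV.
assert (DL := is_derive_root U V L x U' V' HL Hx DU DV).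
assert (Hk : 0 < Fpp (U x) (L x)).
{ unfold Fpp; unfold im2 in Hx; generalize (pow2_ge_0 (L x)); lra. }
unfold crit_im, im2 in *; auto_derive.
- repeat split; try (eexists; eassumption); simpl in Hx |- *; lra.
- derive_rewrite DU; derive_rewrite DL.
  replace (2 * U x + 3 * / 4 * (L x * (L x * 1))) with (2 * U x + 3 / 4 * L x ^ 2) by field.
  assert (Eb := sqrt_sqrt _ (Rlt_le _ _ Hx)); assert (Hb := sqrt_lt_R0 _ Hx).
  set (b := sqrt _) in *; unfold Fpp in *.
  assert (EU : U x = (b ^ 2 - 3 / 4 * L x ^ 2) / 2) by lra.
  rewrite EU in *; field; split; lra.
Qed.

Lemma is_derive_flux (eps : R) (U V L A B C : R -> R) (x U' V' A' B' C' : R) :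
  (forall y, Fp (U y) (V y) (L y) = 0) -> 0 < im2 (U x) (L x) ->
  is_derive U x U' -> is_derive V x V' ->
  is_derive A x A' -> is_derive B x B' -> is_derive C x C' ->
  is_derive (fun s => cutoff eps (crit_im (U s) (L s)) * reFq (U s) (L s) (A s) (B s) (C s)) x
    (flux' eps (U x) (L x) (A x) (B x) (C x) U' V' A' B' C').
Proof.
intros HL Hx DU DV DA DB DC.
assert (DL := is_derive_root U V L x U' V' HL Hx DU DV).
assert (DS := is_derive_crit_im U V L x U' V' HL Hx DU DV).
assert (DK := is_derive_comp (cutoff eps) (fun s => crit_im (U s) (L s)) x _ _
                (is_derive_cutoff eps _) DS).
evar_last.
- apply (is_derive_mult (fun s => cutoff eps (crit_im (U s) (L s)))
          (fun s => reFq (U s) (L s) (A s) (B s) (C s))).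
  + exact DK.
  + unfold reFq; auto_derive; [|reflexivity].
    repeat split; eexists; eassumption.
  + exact Rmult_comm.
- unfold plus, mult, scal; simpl; unfold mult; simpl.
  derive_rewrite DU; derive_rewrite DL; derive_rewrite DA; derive_rewrite DB; derive_rewrite DC.
  unfold flux', reFq, Fpp; assert (3 * L x ^ 2 + 2 * U x <> 0).
  { unfold im2 in Hx; generalize (pow2_ge_0 (L x)); lra. }
  field; trivial.
Qed.

Lemma continuous_flux' {W : UniformSpace} (eps : R)
  (u l a b c u' v' a' b' c' : W -> R) (z : W) :
  0 < im2 (u z) (l z) ->
  continuous u z -> continuous l z ->
  continuous a z -> continuous b z -> continuous c z ->
  continuous u' z -> continuous v' z ->
  continuous a' z -> continuous b' z -> continuous c' z ->
  continuous (fun y => flux' eps (u y) (l y) (a y) (b y) (c y)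
                         (u' y) (v' y) (a' y) (b' y) (c' y)) z.
Proof.
intros Hz Cu Cl Ca Cb Cc Cu' Cv' Ca' Cb' Cc'.
assert (Cs : continuous (fun y => sqrt (2 * u y + 3 / 4 * l y ^ 2)) z).
{ apply (continuous_comp (fun y => 2 * u y + 3 / 4 * l y ^ 2) sqrt);
   [continuity_tac; lra | apply continuous_sqrt]. }
assert (3 * l z ^ 2 + 2 * u z <> 0).
{ unfold im2 in Hz; generalize (pow2_ge_0 (l z)); lra. }
unfold flux', cutoff', cutoff, crit_im, reFq, Fpp, im2; continuity_tac; trivial; lra.
Qed.

(** Writing r = rho + i sigma for the critical value, the left-hand side is the
    divergence of (- psi(sigma) rho_t, psi(sigma) rho_q), that is
    psi'(sigma) (sigma_t rho_q - sigma_q rho_t). The Beltrami equation for r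
    turns it into - psi'(sigma) y |r_q|^2, with y the imaginary part of the root.
    The t-derivatives are already replaced by means of the system; m', n', k'
    stand for u_qq, v_qq, w_qq. *)
Lemma flux_divergence (eps u v l a b c m' n' k' : R) :
  Fp u v l = 0 -> 0 < im2 u l ->
  - flux' eps u l (- b) (2 * u * a - c) (v * a) a b (- n') (2 * a ^ 2 + 2 * u * m' - k')
      (b * a + v * m')
  + flux' eps u l a b c (- b) (2 * u * a - c) (- n') (2 * a ^ 2 + 2 * u * m' - k')
      (b * a + v * m')
  = - (cutoff' eps (crit_im u l) * sqrt (im2 u l)
       * (reFq u l a b c ^ 2 + im2 u l * (b - l * a) ^ 2)).
Proof.
intros H Hp; unfold flux', Fp in *.
assert (E : v = - l ^ 3 - 2 * u * l) by lra; rewrite E; clear E H.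
generalize (sqrt (im2 u l)) (cutoff' eps (crit_im u l)) (cutoff eps (crit_im u l)).
intros s g' g; unfold reFq, Fpp, im2 in *; field.
generalize (pow2_ge_0 l); lra.
Qed.

Lemma locally_slice_q (P : R * R -> Prop) (q t : R) :
  locally (q, t) P -> locally q (fun x => P (x, t)).
Proof. intros [e He]; exists e; intros x Hx; apply He; split; [exact Hx | apply ball_center]. Qed.

Lemma locally_slice_t (P : R * R -> Prop) (q t : R) :
  locally (q, t) P -> locally t (fun s => P (q, s)).
Proof. intros [e He]; exists e; intros x Hx; apply He; split; [apply ball_center | exact Hx]. Qed.

(** This makes the imaginary part of the critical value small where D is
    small, so that the cut-off acts near the boundary of the elliptic region. *)
Lemma crit_im_sqr_le (u v l : R) :
  Fp u v l = 0 -> crit_im u l ^ 2 <= l ^ 2 * Rmax 0 (discr u v) / 4.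
Proof.
intros H; rewrite (discr_factor _ _ _ H); unfold crit_im.
destruct (Rle_or_lt (im2 u l) 0) as [Hi|Hi].
- rewrite sqrt_neg_0 by exact Hi.
  replace ((- l * 0 ^ 3) ^ 2) with 0 by ring.
  apply Rmult_le_pos; [|lra]; apply Rmult_le_pos; [apply pow2_ge_0 | apply Rmax_l].
- replace ((- l * sqrt (im2 u l) ^ 3) ^ 2)
    with (l ^ 2 * (sqrt (im2 u l) * sqrt (im2 u l)) ^ 3) by ring.
  rewrite sqrt_sqrt by lra.
  assert (Hk : im2 u l ^ 2 <= Fpp u l ^ 2).
  { apply pow_incr; unfold Fpp, im2 in *; generalize (pow2_ge_0 l); lra. }
  apply Rle_trans with (l ^ 2 * (im2 u l * Fpp u l ^ 2)).
  + apply Rmult_le_compat_l; [apply pow2_ge_0|].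
    simpl (_ ^ 3); simpl in Hk; nra.
  + rewrite Rmax_right; [lra|].
    apply Rmult_le_pos; [lra | apply pow2_ge_0].
Qed.

Lemma cutoff_small (eps x : R) : x ^ 2 <= eps -> cutoff eps x = 0 /\ cutoff' eps x = 0.
Proof. intros H; unfold cutoff, cutoff'; rewrite Rmax_left by lra; split; ring. Qed.

Lemma cutoff'_ge_0 (eps x : R) : 0 <= cutoff' eps x.
Proof.
unfold cutoff'.
generalize (pow2_ge_0 (Rmax 0 (x ^ 2 - eps))) (pow2_ge_0 x) (Rmax_l 0 (x ^ 2 - eps)).
nra.
Qed.
(** The flux psi(sigma) (- rho_t, rho_q), extended by zero outside D > 0, is
    C^1 and periodic, and its divergence is nonpositive. Hence the divergence
    vanishes, which gives r_q = 0 where psi'(sigma) > 0. Both the real and the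
    imaginary part of F_q at the nonreal root are then zero. *)
Lemma elliptic_invariants_constant u v w Q T :
  torus_solution u v w Q T ->
  forall q t, 0 < discr (u q t) (v q t) -> v q t <> 0 ->
  exists l, l ^ 3 + 2 * u q t * l + v q t = 0 /\
    dq v q t = l * dq u q t /\ dq w q t = (2 * u q t + l ^ 2) * dq u q t.
Proof.
intros S q1 t1 Hd1 Hv1.
assert (Su := sol_smooth_u _ _ _ _ _ S); assert (Sv := sol_smooth_v _ _ _ _ _ S).
assert (Sw := sol_smooth_w _ _ _ _ _ S).
assert (Squ := smooth_dq u Su); assert (Sqv := smooth_dq v Sv); assert (Sqw := smooth_dq w Sw).
assert (Stu := smooth_dt u Su); assert (Stv := smooth_dt v Sv); assert (Stw := smooth_dt w Sw).
assert (Sqtu := smooth_dq _ Stu); assert (Sqtv := smooth_dq _ Stv); assert (Sqtw := smooth_dq _ Stw).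
assert (Stqu := smooth_dt _ Squ); assert (Stqv := smooth_dt _ Sqv); assert (Stqw := smooth_dt _ Sqw).
pose (l q t := real_root (u q t) (v q t)).
assert (Hl : forall q t, Fp (u q t) (v q t) (l q t) = 0) by (intros; apply real_rootP).
assert (Hi1 : 0 < im2 (u q1 t1) (l q1 t1)).
{ rewrite (discr_factor _ _ _ (Hl q1 t1)) in Hd1; apply Rnot_le_lt; intros H.
  generalize (pow2_ge_0 (Fpp (u q1 t1) (l q1 t1))); nra. }
assert (Hl1 : l q1 t1 <> 0).
{ intros H; apply Hv1; generalize (Hl q1 t1); unfold Fp; rewrite H; lra. }
assert (Hs1 : 0 < crit_im (u q1 t1) (l q1 t1) ^ 2).
{ apply pow2_gt_0; unfold crit_im; apply Rmult_integral_contrapositive_currified.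
  - now apply Ropp_neq_0_compat.
  - apply pow_nonzero, Rgt_not_eq, sqrt_lt_R0, Hi1. }
(* With this eps the point (q1, t1) lies where the cut-off is strictly increasing. *)
pose (eps := crit_im (u q1 t1) (l q1 t1) ^ 2 / 2).
assert (Heps : 0 < eps) by (unfold eps; lra).
pose (s q t := crit_im (u q t) (l q t)).
pose (Y q t := cutoff eps (s q t) * reFq (u q t) (l q t) (dq u q t) (dq v q t) (dq w q t)).
pose (X q t := - (cutoff eps (s q t) * reFq (u q t) (l q t) (dt u q t) (dt v q t) (dt w q t))).
pose (Yt q t := flux' eps (u q t) (l q t) (dq u q t) (dq v q t) (dq w q t)
   (dt u q t) (dt v q t) (dt (dq u) q t) (dt (dq v) q t) (dt (dq w) q t)).
pose (Xq q t := - flux' eps (u q t) (l q t) (dt u q t) (dt v q t) (dt w q t)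
   (dq u q t) (dq v q t) (dq (dt u) q t) (dq (dt v) q t) (dq (dt w) q t)).
(* Near a point outside the elliptic region the flux is zero. *)
assert (Hout : forall q t, im2 (u q t) (l q t) <= 0 ->
  locally (q, t) (fun z => cutoff eps (s (fst z) (snd z)) = 0 /\
                           cutoff' eps (s (fst z) (snd z)) = 0)).
{ intros q t Hi.
  pose (h q t := eps - (1 + 2 * Rabs (u q t) + Rabs (v q t)) ^ 2
                       * Rmax 0 (discr (u q t) (v q t)) / 4).
  assert (Ch : continuous (fun z => h (fst z) (snd z)) (q, t)).
  { assert (C1 : continuous (fun z => Rabs (u (fst z) (snd z))) (q, t)).
    { apply (continuous_comp (fun z => u (fst z) (snd z)) Rabs);
       [now apply smooth_continuous | apply continuous_Rabs]. }
    assert (C2 : continuous (fun z => Rabs (v (fst z) (snd z))) (q, t)).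
    { apply (continuous_comp (fun z => v (fst z) (snd z)) Rabs);
       [now apply smooth_continuous | apply continuous_Rabs]. }
    unfold h, discr; continuity_tac; lra. }
  assert (Hh : 0 < h q t).
  { unfold h; rewrite (discr_factor _ _ _ (Hl q t)), Rmax_left; [lra|].
    generalize (pow2_ge_0 (Fpp (u q t) (l q t))); nra. }
  generalize (continuous_locally_positive _ _ Ch Hh); apply filter_imp.
  intros [x y]; simpl; unfold h; intros H; apply cutoff_small.
  apply Rle_trans with (1 := crit_im_sqr_le _ _ _ (Hl x y)).
  assert (Hb : l x y ^ 2 <= (1 + 2 * Rabs (u x y) + Rabs (v x y)) ^ 2).
  { rewrite <- pow2_abs; apply pow_incr; split; [apply Rabs_pos | apply real_root_bound]. }
  assert (H0 := Rmax_l 0 (discr (u x y) (v x y))); nra. }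
assert (Cl : forall q t, 0 < im2 (u q t) (l q t) ->
          continuous (fun z : R * R => l (fst z) (snd z)) (q, t)).
{ intros q t Hi.
  apply (continuous_root (fun z : R * R => u (fst z) (snd z))
          (fun z => v (fst z) (snd z)) (fun z => l (fst z) (snd z)) (q, t)).
  - intros z; apply Hl.
  - exact Hi.
  - now apply smooth_continuous.
  - now apply smooth_continuous. }
assert (CY : continuous2 Y).
{ intros [q t]; destruct (Rle_or_lt (im2 (u q t) (l q t)) 0) as [Hi|Hi].
  - apply continuous_ext_loc with (g := fun _ => 0); [|apply continuous_const].
    generalize (Hout q t Hi); apply filter_imp; intros z [Hz _].
    change (0 = Y (fst z) (snd z)); unfold Y; rewrite Hz; ring.
  - assert (Hc := Cl q t Hi).
    assert (Cs : continuous (fun z : R * R => sqrt (2 * u (fst z) (snd z)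
                              + 3 / 4 * l (fst z) (snd z) ^ 2)) (q, t)).
    { apply (continuous_comp (fun z : R * R => 2 * u (fst z) (snd z)
                              + 3 / 4 * l (fst z) (snd z) ^ 2) sqrt);
       [clearbody l; continuity_tac; lra | apply continuous_sqrt]. }
    unfold Y, s, cutoff, crit_im, reFq, im2; clearbody l; continuity_tac; lra. }
assert (CYt : continuous2 Yt).
{ intros [q t]; destruct (Rle_or_lt (im2 (u q t) (l q t)) 0) as [Hi|Hi].
  - apply continuous_ext_loc with (g := fun _ => 0); [|apply continuous_const].
    generalize (Hout q t Hi); apply filter_imp; unfold s; intros z [Hz1 Hz2].
    change (0 = Yt (fst z) (snd z)); unfold Yt, flux'; rewrite Hz1, Hz2; ring.
  - unfold Yt; apply (continuous_flux' eps); first [exact Hi | exact (Cl q t Hi)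
      | apply smooth_continuous; assumption]. }
assert (CXq : continuous2 Xq).
{ intros [q t]; destruct (Rle_or_lt (im2 (u q t) (l q t)) 0) as [Hi|Hi].
  - apply continuous_ext_loc with (g := fun _ => 0); [|apply continuous_const].
    generalize (Hout q t Hi); apply filter_imp; unfold s; intros z [Hz1 Hz2].
    change (0 = Xq (fst z) (snd z)); unfold Xq, flux'; rewrite Hz1, Hz2; ring.
  - unfold Xq; apply continuous_Ropp, (continuous_flux' eps); first [exact Hi | exact (Cl q t Hi)
      | apply smooth_continuous; assumption]. }
assert (DY : forall q t, is_derive (fun x => Y q x) t (Yt q t)).
{ intros q t; destruct (Rle_or_lt (im2 (u q t) (l q t)) 0) as [Hi|Hi].
  - assert (H := locally_slice_t _ q t (Hout q t Hi)); simpl in H.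
    replace (Yt q t) with 0.
    + apply is_derive_ext_loc with (f := fun _ => 0);
        [|apply (is_derive_const (V := R_NormedModule) 0)].
      revert H; apply filter_imp; intros x [Hx _].
      change (0 = Y q x); unfold Y; rewrite Hx; ring.
    + apply locally_singleton in H; destruct H as [H1 H2]; unfold s in H1, H2.
      unfold Yt, flux'; rewrite H1, H2; ring.
  - apply (is_derive_flux eps (u q) (v q) (l q) (dq u q) (dq v q) (dq w q) t);
      first [exact Hi | exact (Hl q) | apply smooth_is_derive_t; assumption]. }
assert (DX : forall q t, is_derive (fun x => X x t) q (Xq q t)).
{ intros q t; destruct (Rle_or_lt (im2 (u q t) (l q t)) 0) as [Hi|Hi].
  - assert (H := locally_slice_q _ q t (Hout q t Hi)); simpl in H.
    replace (Xq q t) with 0.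
    + apply is_derive_ext_loc with (f := fun _ => 0);
        [|apply (is_derive_const (V := R_NormedModule) 0)].
      revert H; apply filter_imp; intros x [Hx _].
      change (0 = X x t); unfold X; rewrite Hx; ring.
    + apply locally_singleton in H; destruct H as [H1 H2]; unfold s in H1, H2.
      unfold Xq, flux'; rewrite H1, H2; ring.
  - apply (is_derive_opp (V := R_NormedModule)
      (fun x => cutoff eps (s x t) * reFq (u x t) (l x t) (dt u x t) (dt v x t) (dt w x t))).
    apply (is_derive_flux eps (fun x => u x t) (fun x => v x t) (fun x => l x t)
      (fun x => dt u x t) (fun x => dt v x t) (fun x => dt w x t) q);
      first [exact Hi | exact (fun x => Hl x t) | apply smooth_is_derive_q; assumption]. }
assert (Hdiv : forall q t, Xq q t + Yt q t =
  - (cutoff' eps (s q t) * sqrt (im2 (u q t) (l q t))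
     * (reFq (u q t) (l q t) (dq u q t) (dq v q t) (dq w q t) ^ 2
        + im2 (u q t) (l q t) * (dq v q t - l q t * dq u q t) ^ 2))).
{ intros q t; destruct (Rle_or_lt (im2 (u q t) (l q t)) 0) as [Hi|Hi].
  - destruct (locally_singleton _ _ (Hout q t Hi)) as [H1 H2]; simpl in H1, H2.
    rewrite H2; unfold s in H1, H2.
    unfold Xq, Yt, flux'; rewrite H1, H2; ring.
  - unfold s; rewrite <- (flux_divergence eps (u q t) (v q t) (l q t) _ _ _
      (dq (dq u) q t) (dq (dq v) q t) (dq (dq w) q t) (Hl q t) Hi).
    unfold Xq, Yt; rewrite <- !smooth_Schwarz by assumption.
    now rewrite (sol_dt_u _ _ _ _ _ S), (sol_dt_v _ _ _ _ _ S), (sol_dt_w _ _ _ _ _ S),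
      (sol_dqt_u _ _ _ _ _ _ _ S), (sol_dqt_v _ _ _ _ _ _ _ S),
      (sol_dqt_w _ _ _ _ _ _ _ S). }
assert (Hzero := torus_nonpositive_divergence X Y Xq Yt Q T).
assert (Hz1 : Xq q1 t1 + Yt q1 t1 = 0).
{ apply Hzero; trivial; try apply S.
  - intros q t; unfold X, s, l.
    now rewrite (sol_uQ _ _ _ _ _ S), (sol_vQ _ _ _ _ _ S),
      (dt_shift_q u Q (sol_uQ _ _ _ _ _ S)), (dt_shift_q v Q (sol_vQ _ _ _ _ _ S)),
      (dt_shift_q w Q (sol_wQ _ _ _ _ _ S)).
  - intros q t; unfold Y, s, l.
    now rewrite (sol_uT _ _ _ _ _ S), (sol_vT _ _ _ _ _ S),
      (dq_shift_t u T (sol_uT _ _ _ _ _ S)), (dq_shift_t v T (sol_vT _ _ _ _ _ S)),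
      (dq_shift_t w T (sol_wT _ _ _ _ _ S)).
  - intros q t; rewrite Hdiv.
    destruct (Rle_or_lt (im2 (u q t) (l q t)) 0) as [Hi|Hi].
    + destruct (locally_singleton _ _ (Hout q t Hi)) as [_ H2]; simpl in H2; rewrite H2; lra.
    + apply Ropp_le_cancel; rewrite Ropp_0, Ropp_involutive.
      apply Rmult_le_pos; [apply Rmult_le_pos; [apply cutoff'_ge_0 | apply sqrt_pos]|].
      generalize (pow2_ge_0 (dq v q t - l q t * dq u q t))
        (pow2_ge_0 (reFq (u q t) (l q t) (dq u q t) (dq v q t) (dq w q t))); nra. }
rewrite Hdiv in Hz1.
assert (Hc : 0 < cutoff' eps (s q1 t1)).
{ unfold cutoff'; rewrite Rmax_right by (unfold s, eps; lra).
  assert (0 < s q1 t1 ^ 2 - eps) by (unfold s, eps; lra).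
  generalize (pow2_ge_0 (s q1 t1)); intros; nra. }
assert (Hb := sqrt_lt_R0 _ Hi1).
assert (Hsum : reFq (u q1 t1) (l q1 t1) (dq u q1 t1) (dq v q1 t1) (dq w q1 t1) ^ 2
   + im2 (u q1 t1) (l q1 t1) * (dq v q1 t1 - l q1 t1 * dq u q1 t1) ^ 2 = 0).
{ apply Rmult_eq_reg_l with (cutoff' eps (s q1 t1) * sqrt (im2 (u q1 t1) (l q1 t1)));
   [lra | apply Rgt_not_eq; now apply Rmult_lt_0_compat]. }
assert (P1 := pow2_ge_0 (reFq (u q1 t1) (l q1 t1) (dq u q1 t1) (dq v q1 t1) (dq w q1 t1))).
assert (P2 := pow2_ge_0 (dq v q1 t1 - l q1 t1 * dq u q1 t1)).
assert (Z2 : dq v q1 t1 - l q1 t1 * dq u q1 t1 = 0).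
{ apply NNPP; intros H; apply pow2_gt_0 in H; nra. }
assert (Z1 : reFq (u q1 t1) (l q1 t1) (dq u q1 t1) (dq v q1 t1) (dq w q1 t1) = 0).
{ apply NNPP; intros H; apply pow2_gt_0 in H; nra. }
exists (l q1 t1); split; [exact (Hl q1 t1)|].
assert (E1 : dq v q1 t1 = l q1 t1 * dq u q1 t1) by lra.
split; [exact E1|]; unfold reFq in Z1; rewrite E1 in Z1; lra.
Qed.
(** * Three distinct real roots, and double roots *)

(** With s = sqrt (- 2 u / 3) the critical points of F_p are - s and s, and
    D < 0 means |v| < 2 s^3. The outer roots lie in (- 2 s, - s) and (s, 2 s). *)
Lemma three_real_roots (u v : R) :
  discr u v < 0 ->
  u < 0 /\ exists x y, x <> y /\ Fp u v x = 0 /\ Fp u v y = 0 /\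
    0 < Fpp u x /\ 0 < Fpp u y.
Proof.
unfold discr; intros Hd.
assert (Hu : u < 0).
{ apply Rnot_le_lt; intros H; generalize (pow_le u 3 H) (pow2_ge_0 v); lra. }
split; [exact Hu|].
pose (s := sqrt (- 2 * u / 3)).
assert (Hs : 0 < s) by (apply sqrt_lt_R0; lra).
assert (Es : s * s = - 2 * u / 3) by (apply sqrt_sqrt; lra).
clearbody s; assert (Eu : u = - 3 / 2 * s ^ 2) by lra; clear Es Hu; subst u.
assert (Hv : - (2 * s ^ 3) < v < 2 * s ^ 3).
{ assert (Hv2 : v ^ 2 < (2 * s ^ 3) ^ 2) by (ring_simplify in Hd; ring_simplify; lra).
  assert (0 < 2 * s ^ 3) by (generalize (pow_lt s 3 Hs); lra); nra. }
assert (Cont : continuity (Fp (- 3 / 2 * s ^ 2) v)).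
{ intros p; apply continuity_pt_filterlim; unfold Fp.
  apply (ex_derive_continuous (fun p => p ^ 3 + 2 * (- 3 / 2 * s ^ 2) * p + v)).
  auto_derive; trivial. }
assert (F1 : Fp (- 3 / 2 * s ^ 2) v s = v - 2 * s ^ 3) by (unfold Fp; field).
assert (F2 : Fp (- 3 / 2 * s ^ 2) v (2 * s) = v + 2 * s ^ 3) by (unfold Fp; field).
assert (F3 : Fp (- 3 / 2 * s ^ 2) v (- s) = v + 2 * s ^ 3) by (unfold Fp; field).
assert (F4 : Fp (- 3 / 2 * s ^ 2) v (- (2 * s)) = v - 2 * s ^ 3) by (unfold Fp; field).
destruct (IVT_cor _ s (2 * s) Cont) as [y [Hy Ry]]; [lra | rewrite F1, F2; nra |].
destruct (IVT_cor _ (- (2 * s)) (- s) Cont) as [x [Hx Rx]]; [lra | rewrite F3, F4; nra |].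
assert (Hy' : y <> s) by (intros ->; lra).
assert (Hx' : x <> - s) by (intros ->; lra).
exists x, y; split; [lra|]; repeat split; trivial; unfold Fpp.
- assert (x < - s) by lra; nra.
- assert (s < y) by lra; nra.
Qed.

(** If F_q vanishes at two roots x and y, then F_q(p) = u_q (p - x) (p - y), and
    the third root is - (x + y). *)
Lemma middle_root (u v x y a b c : R) :
  x <> y -> Fp u v x = 0 -> Fp u v y = 0 -> Fq a b c x = 0 -> Fq a b c y = 0 ->
  exists l, l ^ 3 + 2 * u * l + v = 0 /\ b = l * a /\ c = (2 * u + l ^ 2) * a.
Proof.
unfold Fp, Fq; intros Hxy Hx Hy Ax Ay; exists (- (x + y)).
assert (Eu : 2 * u = - (x ^ 2 + x * y + y ^ 2)).
{ apply Rmult_eq_reg_l with (x - y); lra. }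
assert (Ev : v = - x ^ 3 - 2 * u * x) by lra; rewrite Eu in Ev.
assert (Eb : b = - (x + y) * a) by (apply Rmult_eq_reg_l with (x - y); lra).
assert (Ec : c = - a * x ^ 2 - b * x) by lra; rewrite Eb in Ec.
rewrite Eu, Ev, Ec, Eb; repeat split; ring.
Qed.

(** Let m be the double root. Differentiating D = 0 in q and in t, and using the
    system, gives F_q(p) = u_q (p - m)^2. As F_q also vanishes at the simple root
    - 2 m, it is zero. *)
Lemma double_root_trivial u v w Q T :
  torus_solution u v w Q T ->
  (forall p q t, u q t <= 0 -> Fp (u q t) (v q t) p = 0 -> 0 < Fpp (u q t) p ->
    Fq (dq u q t) (dq v q t) (dq w q t) p = 0) ->
  forall q t, v q t <> 0 ->
    locally (q, t) (fun z : R * R => discr (u (fst z) (snd z)) (v (fst z) (snd z)) = 0) ->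
    dq u q t = 0 /\ dq v q t = 0 /\ dq w q t = 0.
Proof.
intros S Hreal q t Hv Hloc.
assert (Su := sol_smooth_u _ _ _ _ _ S); assert (Sv := sol_smooth_v _ _ _ _ _ S).
assert (D : forall (U V : R -> R) x U' V', is_derive U x U' -> is_derive V x V' ->
   locally x (fun y => discr (U y) (V y) = 0) -> 96 * U x ^ 2 * U' + 54 * V x * V' = 0).
{ intros U V x U' V' DU DV HL.
  apply (is_derive_loc_zero (fun y => discr (U y) (V y)) x); [|exact HL].
  unfold discr; auto_derive.
  - repeat split; eexists; eassumption.
  - derive_rewrite DU; derive_rewrite DV; ring. }
assert (G1 := D _ _ q _ _ (smooth_is_derive_q u q t Su) (smooth_is_derive_q v q t Sv)
  (locally_slice_q _ q t Hloc)).
assert (G2 := D _ _ t _ _ (smooth_is_derive_t u q t Su) (smooth_is_derive_t v q t Sv)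
  (locally_slice_t _ q t Hloc)).
assert (H0 := locally_singleton _ _ Hloc); simpl in H0.
rewrite (sol_dt_u _ _ _ _ _ S), (sol_dt_v _ _ _ _ _ S) in G2.
generalize (Hreal (3 * v q t / (2 * u q t)) q t); intros Hr.
(* Hr is the vanishing of F_q at the simple root 3 v / (2 u). *)
set (a := dq u q t) in *; set (b := dq v q t) in *; set (c := dq w q t) in *.
set (x := u q t) in *; set (y := v q t) in *; clearbody a b c x y; clear D Hloc.
assert (Hx : x < 0).
{ unfold discr in H0; apply Rnot_le_lt; intros H.
  generalize (pow_le x 3 H) (pow2_gt_0 y Hv); lra. }
pose (m := - 3 * y / (4 * x)).
assert (Ey : y = - 4 / 3 * x * m) by (unfold m; field; lra).
assert (Ex : x = - 3 / 2 * m ^ 2).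
{ unfold discr in H0; rewrite Ey in H0.
  apply Rmult_eq_reg_l with (x ^ 2); [lra | apply pow_nonzero; lra]. }
assert (Er : 3 * y / (2 * x) = - 2 * m) by (unfold m; field; lra).
rewrite Er in Hr; clear Er; clearbody m.
assert (Hm : m <> 0) by (intros H; rewrite H in Ex; lra).
rewrite Ex in Ey; subst x y.
assert (Eb : b = - 2 * m * a).
{ apply Rmult_eq_reg_l with (m ^ 3); [lra | now apply pow_nonzero]. }
assert (Ec : c = m ^ 2 * a).
{ rewrite Eb in G2; apply Rmult_eq_reg_l with (m ^ 3); [lra | now apply pow_nonzero]. }
assert (Hm2 := pow2_gt_0 m Hm).
unfold Fp, Fpp, Fq in Hr; rewrite Eb, Ec in Hr.
assert (H9 : 9 * m ^ 2 * a = 0).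
{ rewrite <- Hr; [ring | lra | field | nra]. }
assert (Ha : a = 0) by (apply Rmult_eq_reg_l with (9 * m ^ 2); lra).
rewrite Eb, Ec, Ha; repeat split; ring.
Qed.

(** * Independence of t *)

(** Where v <> 0, the vanishing of F_q gives that of F_t through the system.
    Around a point with F_t <> 0 this leaves only v = 0, which also makes
    u_t = - v_q, v_t and w_t = v u_q vanish. *)
Lemma sol_stationary u v w Q T :
  torus_solution u v w Q T ->
  forall q t, dt u q t = 0 /\ dt v q t = 0 /\ dt w q t = 0.
Proof.
intros S.
assert (Su := sol_smooth_u _ _ _ _ _ S); assert (Sv := sol_smooth_v _ _ _ _ _ S).
assert (Sw := sol_smooth_w _ _ _ _ _ S).
assert (Stu := smooth_dt u Su); assert (Stv := smooth_dt v Sv); assert (Stw := smooth_dt w Sw).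
assert (Hell : forall q t, 0 < discr (u q t) (v q t) -> v q t <> 0 ->
   dq u q t = 0 /\ dq v q t = 0 /\ dq w q t = 0).
{ intros q t Hd Hv; apply (one_invariant_trivial u v w Q T 1 S); trivial; [|lra].
  intros x s Hx; apply (elliptic_invariants_constant u v w Q T S); lra. }
assert (Hreal := real_invariant_constant u v w Q T S Hell).
assert (Hhyp : forall q t, discr (u q t) (v q t) < 0 -> v q t <> 0 ->
   dq u q t = 0 /\ dq v q t = 0 /\ dq w q t = 0).
{ intros q t Hd Hv; apply (one_invariant_trivial u v w Q T (-1) S); trivial; [|lra].
  intros x s Hx _; destruct (three_real_roots (u x s) (v x s)) as (Hu & y & z & Hyz & H);
    [lra|]; destruct H as (Ry & Rz & Py & Pz).
  apply (middle_root _ _ y z); trivial; apply Hreal; trivial; lra. }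
intros q t; apply NNPP; intros Hne.
pose (E q t := dt u q t ^ 2 + dt v q t ^ 2 + dt w q t ^ 2).
assert (HE : forall q t, dq u q t = 0 /\ dq v q t = 0 /\ dq w q t = 0 -> E q t = 0).
{ intros x s (H1 & H2 & H3); unfold E.
  rewrite (sol_dt_u _ _ _ _ _ S), (sol_dt_v _ _ _ _ _ S), (sol_dt_w _ _ _ _ _ S), H1, H2, H3.
  ring. }
assert (CE : forall z, continuous (fun z : R * R => E (fst z) (snd z)) z).
{ intros z; unfold E; continuity_tac. }
assert (HEp : 0 < E q t).
{ unfold E; apply Rnot_le_lt; intros H; apply Hne.
  generalize (pow2_ge_0 (dt u q t)) (pow2_ge_0 (dt v q t)) (pow2_ge_0 (dt w q t)).
  intros P1 P2 P3; repeat split; apply NNPP; intros H0; apply pow2_gt_0 in H0; lra. }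
(* Where v <> 0 near (q, t), F_t <> 0 forces D = 0 on an open set. *)
assert (Hv : locally (q, t) (fun z : R * R => v (fst z) (snd z) = 0)).
{ generalize (continuous_locally_positive _ (q, t) (CE (q, t)) HEp); intros HEl.
  apply locally_locally in HEl; revert HEl; apply filter_imp; intros [x s] HEl; simpl.
  apply NNPP; intros Hv.
  assert (HEx := locally_singleton _ _ HEl); simpl in HEx.
  assert (Hvl : locally (x, s) (fun z : R * R => 0 < v (fst z) (snd z) ^ 2)).
  { apply (continuous_locally_positive (fun z : R * R => v (fst z) (snd z) ^ 2)).
    - continuity_tac.
    - now apply pow2_gt_0. }
  assert (H0 : E x s = 0); [|lra].
  apply HE, (double_root_trivial u v w Q T S Hreal); trivial.
  generalize (filter_and _ _ HEl Hvl); apply filter_imp.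
  intros [y r] [H1 H2]; simpl in H1, H2 |- *.
  assert (Hvy : v y r <> 0) by (intros H; rewrite H in H2; lra).
  destruct (Rtotal_order (discr (u y r) (v y r)) 0) as [H|[H|H]]; trivial.
  - rewrite (HE y r) in H1 by (apply Hhyp; trivial); lra.
  - rewrite (HE y r) in H1 by (apply Hell; trivial); lra. }
assert (Hq := locally_slice_q _ q t Hv); assert (Ht := locally_slice_t _ q t Hv).
simpl in Hq, Ht.
assert (Z1 := is_derive_loc_zero _ _ _ (smooth_is_derive_q v q t Sv) Hq).
assert (Z2 := is_derive_loc_zero _ _ _ (smooth_is_derive_t v q t Sv) Ht).
apply locally_singleton in Hv; simpl in Hv.
unfold E in HEp; rewrite (sol_dt_u _ _ _ _ _ S), (sol_dt_w _ _ _ _ _ S), Z1, Z2, Hv in HEp.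
lra.
Qed.

Lemma indep_of_t_of_dt_zero (u : R -> R -> R) :
  smooth u -> (forall q t, dt u q t = 0) -> indep_of_t u.
Proof.
intros Su H q t s; apply is_derive_zero_const; intros x.
rewrite <- (H q x); now apply smooth_is_derive_t.
Qed.

Theorem theorem1p1 (u1 u2 u3 : R -> R -> R)
    (smooth_u1 : smooth u1) (smooth_u2 : smooth u2) (smooth_u3 : smooth u3)
    (periodic_u1 : biperiodic u1) (periodic_u2 : biperiodic u2)
    (periodic_u3 : biperiodic u3)
    (system : quasilinear_system u1 u2 u3) :
  indep_of_t u1 /\ indep_of_t u2 /\ indep_of_t u3.
Proof.
destruct (common_periods u1 u2 u3) as (Q & T & S); trivial.
assert (H := sol_stationary u1 u2 u3 Q T S).
repeat split; apply indep_of_t_of_dt_zero; trivial; intros q t; apply H.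
Qed.
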